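(* Let $T$ be a complete first-order theory with an infinite model and let $\mathcal{M}$ be a monster model of $T$. Let $\kappa,\kappa_0,\kappa_1$ be cardinals with $\kappa+1=\kappa_0+\kappa_1$. Let $x=x_0x_1$ be a finite tuple of variables split into two subtuples $x_0$ and $x_1$. Suppose there is an srd-pattern of width $\kappa$ witnessed by formulas $\varphi_i(x;y_i)$ $(i\in\kappa)$. Then there is $l\in\{0,1\}$ and there are formulas $\psi_i(x_l;y'_i)$ $(i\in\kappa_l)$ (in the variables $x_l$, with some parameter variables $y'_i$) together with tuples $c_{i,j}$ $(i\in\kappa_l,\ j\in\omega)$ such that $\langle(\psi_i(x_l;y'_i))_{i\in\kappa_l},(c_{i,j})_{i\in\kappa_l,j\in\omega}\rangle$ is an srd-pattern of width $\kappa_l$.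
   Context: Work in a monster model $\mathcal{M}$ of $T$. For a formula $\varphi$ and a condition $( * )$, $\varphi^{\text{if }( * )}$ denotes $\varphi$ if $( * )$ is true and $\neg\varphi$ if $( * )$ is false. For a formula $\varphi(x,b)$, $\varphi(\mathcal{M},b)=\{a\in\mathcal{M}^{|x|}:\mathcal{M}\models\varphi(a,b)\}$. Given a cardinal $\kappa$, formulas $\varphi_i(x;y_i)$ $(i\in\kappa)$ (all in the same variable tuple $x$) and tuples $b_{i,j}$ $(i\in\kappa, j\in\omega)$ with $|b_{i,j}|=|y_i|$, the pair $\langle(\varphi_i(x;y_i))_{i\in\kappa},(b_{i,j})_{i\in\kappa,j\in\omega}\rangle$ is an srd-pattern of width $\kappa$ if (a) for every $\eta\in\omega^\kappa$, the set $\{\varphi_i(x;b_{i,j})^{\text{if }(j\geq\eta(i))}: i\in\kappa, j\in\omega\}$ is consistent, and (b) for each $i\in\kappa$ and $j\in\omega$, $\varphi_i(\mathcal{M},b_{i,j})\subsetneq\varphi_i(\mathcal{M},b_{i,j+1})$. *)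

(* Defs.v *)
From mathcomp Require Export all_boot.
From mathcomp Require Export boolp classical_sets functions cardinality.

Set Implicit Arguments.
Unset Strict Implicit.
Unset Printing Implicit Defensive.

#[export] Set Implicit Arguments.
#[export] Unset Strict Implicit.
#[export] Unset Printing Implicit Defensive.

Local Open Scope classical_set_scope.
Local Open Scope card_scope.

(* Cardinals are represented by types up to equipotence. *)

Definition card_lt (S K : Type) : Prop :=
  [set: S] #<= [set: K] /\ ~ ([set: K] #<= [set: S]).

Record language := Language {
  fsym : Type;
  farity : fsym -> nat;
  rsym : Type;
  rarity : rsym -> nat }.

Record structure (L : language) := Structure {
  carrier :> Type;
  carrier_inhabited : inhabited carrier;
  finterp : forall f : fsym L, ('I_(farity f) -> carrier) -> carrier;
  rinterp : forall r : rsym L, ('I_(rarity r) -> carrier) -> Prop }.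

Inductive term (L : language) (V : Type) : Type :=
  | Var (v : V)
  | App (f : fsym L) (args : 'I_(farity f) -> term L V).

(* [formula L V]: L-formulas whose free variables are taken in V.  The variable
   bound by [FEx] is [None : option V]. *)
Inductive formula (L : language) (V : Type) : Type :=
  | FEq (s t : term L V)
  | FRel (r : rsym L) (args : 'I_(rarity r) -> term L V)
  | FNeg (phi : formula L V)
  | FAnd (phi psi : formula L V)
  | FEx (phi : formula L (option V)).

Section Syntax.
Variable L : language.

Fixpoint trename (V W : Type) (h : V -> W) (t : term L V) : term L W :=
  match t with
  | Var v => Var L (h v)
  | App f args => App (fun k => trename h (args k))
  end.

Fixpoint frename (V W : Type) (h : V -> W) (phi : formula L V) : formula L W :=
  match phi with
  | FEq s t => FEq (trename h s) (trename h t)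
  | FRel r args => FRel (fun k => trename h (args k))
  | FNeg phi => FNeg (frename h phi)
  | FAnd phi psi => FAnd (frename h phi) (frename h psi)
  | FEx phi => FEx (frename (omap h) phi)
  end.

Fixpoint teval (M : structure L) (V : Type) (v : V -> M) (t : term L V) : M :=
  match t with
  | Var x => v x
  | App f args => finterp (fun k => teval v (args k))
  end.

Fixpoint sat (M : structure L) (V : Type) (phi : formula L V) (v : V -> M) :
    Prop :=
  match phi with
  | FEq s t => teval v s = teval v t
  | FRel r args => rinterp (fun k => teval v (args k))
  | FNeg phi => ~ sat phi v
  | FAnd phi psi => sat phi v /\ sat psi v
  | FEx phi => exists a : M, sat phi (fun o => oapp v a o)
  end.

Definition sentence := formula L void.

Definition holds (M : structure L) (s : sentence) : Prop :=
  sat s (fun z : void => of_void M z).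

Definition model (T : set sentence) (M : structure L) : Prop :=
  forall s, T s -> holds M s.

Definition entails (T : set sentence) (s : sentence) : Prop :=
  forall M, model T M -> holds M s.

Definition complete_theory (T : set sentence) : Prop :=
  (exists M, model T M) /\ forall s, entails T s \/ entails T (FNeg s).

Definition has_infinite_model (T : set sentence) : Prop :=
  exists2 M, model T M & infinite_set [set: carrier M].

Definition elementary_embedding (M N : structure L) (f : M -> N) : Prop :=
  forall (n : nat) (phi : formula L 'I_n) (a : 'I_n -> M),
    sat phi a <-> sat phi (f \o a).

Definition partial_elementary (M : structure L) (A : set M) (f : M -> M) :
    Prop :=
  forall (n : nat) (phi : formula L 'I_n) (a : 'I_n -> M),
    (forall k, A (a k)) -> (sat phi a <-> sat phi (f \o a)).

Definition automorphism (M : structure L) (g : M -> M) : Prop :=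
  [/\ bijective g,
      (forall (f : fsym L) (a : 'I_(farity f) -> M),
         g (finterp a) = finterp (g \o a)) &
      (forall (r : rsym L) (a : 'I_(rarity r) -> M),
         rinterp a <-> rinterp (g \o a))].

(* An L_A-formula in the variables X is a formula over X + A: the elements of
   [inr a] play the role of the constants naming a, and are always interpreted
   through a fixed map e from the parameters to the structure. *)

Definition assign (N : Type) (X P : Type) (a : X -> N) (e : P -> N) :
    X + P -> N :=
  fun v => match v with inl x => a x | inr p => e p end.

Definition realizes (N : structure L) (X P : Type) (e : P -> N)
    (S : set (formula L (X + P))) (a : X -> N) : Prop :=
  forall phi, S phi -> sat phi (assign a e).

Definition finitely_satisfiable (N : structure L) (X P : Type) (e : P -> N)
    (S : set (formula L (X + P))) : Prop :=
  forall S0, S0 `<=` S -> finite_set S0 -> exists a, realizes e S0 a.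

(* Consistency with the elementary diagram of M. *)
Definition consistent (M : structure L) (X : Type)
    (S : set (formula L (X + M))) : Prop :=
  exists (N : structure L) (f : M -> N),
    elementary_embedding f /\ exists a, realizes f S a.

Definition saturated (K : Type) (M : structure L) : Prop :=
  forall A : set M, card_lt A K ->
  forall (n : nat) (S : set (formula L ('I_n + A))),
    finitely_satisfiable (fun p : A => val p) S ->
    exists a : 'I_n -> M, realizes (fun p : A => val p) S a.

Definition strongly_homogeneous (K : Type) (M : structure L) : Prop :=
  forall A : set M, card_lt A K ->
  forall f : M -> M, partial_elementary A f ->
    exists2 g, automorphism g & forall a, A a -> g a = f a.

(* K is the cardinal below which sets are small; [formula L nat] has
   cardinality |L| + aleph_0. *)
Definition monster (T : set sentence) (K : Type) (M : structure L) : Prop :=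
  [/\ model T M, card_lt (formula L nat) K, saturated K M &
      strongly_homogeneous K M].

Definition formula_if (c : bool) (V : Type) (phi : formula L V) : formula L V :=
  if c then phi else FNeg phi.

Definition instance (M : structure L) (X Y : Type) (phi : formula L (X + Y))
    (b : Y -> M) : formula L (X + M) :=
  frename (fun v => match v with inl x => inl x | inr y => inr (b y) end) phi.

Definition solutions (M : structure L) (X Y : Type) (phi : formula L (X + Y))
    (b : Y -> M) : set (X -> M) :=
  [set a | sat phi (assign a b)].

Definition srd_pattern (M : structure L) (X : finType) (I : Type)
    (m : I -> nat) (phi : forall i, formula L (X + 'I_(m i)))
    (b : forall i, nat -> 'I_(m i) -> M) : Prop :=
  (forall eta : I -> nat,
     consistent [set psi : formula L (X + M) | exists (i : I) (j : nat),
       psi = formula_if (eta i <= j)%N (instance (phi i) (b i j))]) /\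
  (forall (i : I) (j : nat),
     solutions (phi i) (b i j) `<` solutions (phi i) (b i j.+1)).

End Syntax.

(* Main.v *)
(* Make the rows of the pattern mutually indiscernible and indexed by the integers with two
   added end points, and fix (a0, a1) lying in the middle cut of every row.  For a box of
   intervals in finitely many rows, ask whether the fibre over a0 meets it.  Let S be a
   maximal set of rows such that the fibre meets all boxes on S; then the rows in S, with a0
   as a parameter, form a pattern in x1.  By maximality, each row w outside S has a box that
   is met by the fibre over a0 but missed when one end of its w-side is moved inwards.  The
   formula "the fibre over x0 meets this box", with that end varying, is monotone in the
   varying end, and mutual indiscernibility lets the cut of a0 in all these rows be moved
   independently: the rows outside S give a pattern in x0.  Since the cardinals of S and of
   its complement add up to kappa, and kappa + 1 = kappa_0 + kappa_1, one of the two
   patterns is wide enough. *)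
Require Import Defs.
From Stdlib Require List.
From mathcomp Require Import order ssralg ssrnum ssrint zify.
Local Open Scope classical_set_scope.
Local Open Scope card_scope.

(** * Cardinal arithmetic *)

(** The obstacle is that a box showing maximality at one row may also constrain other rows outside
    S, whose cuts have to move at the same time. The boxes are therefore normalised: in those other
    rows their ends are fixed, either at integers produced by a second maximality argument or at the
    added end points, which lie beyond every column used by a moving cut. The tuple [a0] itself is
    never moved. For finitely many rows, the existence of a tuple with the desired cuts is a
    first-order statement about the array; it is verified with [a0] after relabelling the columns in
    an order-preserving way, and indiscernibility carries it back to the original columns, usually
    with another witness. *)

Definition emb (A B : Type) : Prop := exists f : A -> B, injective f.

Lemma emb_trans A B C : emb A B -> emb B C -> emb A C.
Proof. by move=> [f fI] [g gI]; exists (g \o f); exact: inj_comp. Qed.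

Lemma card_le_embP A B : [set: A] #<= [set: B] <-> emb A B.
Proof.
split=> [/card_leP[f]|[f fI]].
  exists (fun x => val (f (SigSub (mem_setT x)))) => x y /val_inj fxy.
  have /(congr1 val)// : SigSub (mem_setT x) = SigSub (mem_setT y).
  by apply: (@inj _ _ _ f) => //; rewrite inE.
have /injfunPex[g] : exists2 f : A -> B, set_fun setT setT f & set_inj setT f.
  by exists f => // x y _ _; exact: fI.
exact: inj_card_le g.
Qed.

Lemma emb_card_lt A B K : emb A B -> card_lt B K -> card_lt A K.
Proof.
move=> AB [/card_le_embP BK nKB]; split.
  by apply/card_le_embP; exact: emb_trans BK.
by move=> /card_le_embP KA; apply: nKB; apply/card_le_embP; exact: emb_trans AB.
Qed.

(** By Zorn on graphs of partial injections: a maximal one is total on one of the two sides. *)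
Lemma emb_total A B : emb A B \/ emb B A.
Proof.
pose P (G : set (A * B)) := forall p q, G p -> G q -> (p.1 = q.1) <-> (p.2 = q.2).
have [G [PG maxG]] : exists G, P G /\ forall H, G `<` H -> ~ P H.
  apply: Zorn_bigcup => F FP Ftot p q [X FX Xp] [Y FY Yq].
  have [XY|YX] := Ftot _ _ FX FY; first by apply: (FP _ FY) => //; exact: XY.
  by apply: (FP _ FX) => //; exact: YX.
have [Gl|/existsNP[a Ga]] := pselect (forall a, exists b, G (a, b)).
  left; have [f Gf] := choice Gl; exists f => x y fxy.
  by apply/(PG _ _ (Gf x) (Gf y)).
have [Gr|/existsNP[b Gb]] := pselect (forall b, exists a, G (a, b)).
  right; have [f Gf] := choice Gr; exists f => x y fxy.
  by apply/(PG _ _ (Gf x) (Gf y)).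
exfalso; apply: (maxG (G `|` [set (a, b)])).
  by split=> [p|sub]; [left|apply: Ga; exists b; apply: sub; right].
move=> [a1 b1] [a2 b2] [G1|[-> ->]] [G2|[-> ->]] //=.
- exact: (PG _ _ G1 G2).
- by split=> e; [case: Ga; exists b1|case: Gb; exists a1]; rewrite -e.
- by split=> e; [case: Ga; exists b2|case: Gb; exists a2]; rewrite e.
Qed.

Lemma sval_inj A (P : A -> Prop) : injective (@proj1_sig A P).
Proof.
move=> [x px] [y py] /= e; case: y / e py => py.
by rewrite (Prop_irrelevance px py).
Qed.

(* Zorn: a maximal family of disjoint sequences in A leaves out only countably many points. *)
Lemma emb_prod_nat A : emb nat A -> emb (A * nat) A.
Proof.
move=> [s1 s1I].
pose P (G : set (nat -> A)) := forall s t, G s -> G t ->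
  forall n m, s n = t m -> s = t /\ n = m.
have [G [PG maxG]] : exists G, P G /\ forall H, G `<` H -> ~ P H.
  apply: Zorn_bigcup => F FP Ftot s t [X FX Xs] [Y FY Yt].
  have [XY|YX] := Ftot _ _ FX FY; first by apply: (FP _ FY) => //; exact: XY.
  by apply: (FP _ FX) => //; exact: YX.
have [s0 Gs0] : exists s, G s.
  apply: contrapT => /forallNP G0; apply: (maxG [set s1]).
    by split=> [s /G0//|/(_ s1 erefl)/G0].
  by move=> s t -> -> n m /s1I.
pose R := {x | ~ exists s n, G s /\ s n = x}.
have [rho rhoI] : emb R nat.
  have [[f fI]|//] := emb_total nat R; exfalso.
  have sfG s n k : G s -> s n <> sval (f k).
    by move=> Gs e; case: (f k) e => /= x nx e; apply: nx; exists s, n.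
  apply: (maxG (G `|` [set sval \o f])).
    split=> [p|sub]; first by left.
    by apply: (@sfG (sval \o f) 0 0) => //; apply: sub; right.
  move=> s t [Gs|->] [Gt|->] n m /=.
  - exact: PG.
  - by move=> /(sfG _ _ _ Gs).
  - by move=> /esym/(sfG _ _ _ Gt).
  - by move=> e; split=> //; apply/fI/sval_inj.
(* Each x gets a sequence of G and a code in [bool * nat] that together determine it: its position
   in its own sequence, or [s0] and its number if it lies on no sequence. The pair of x and k is
   then sent to the entry of that sequence at the number coding the code of x and k. *)
have F (x : A) : exists q : (nat -> A) * (bool * nat), G q.1 /\
    forall y, (exists p : (nat -> A) * (bool * nat), p = q /\
      ((exists2 n, p.1 n = y & p.2 = (true, n)) \/
       (exists2 r : R, sval r = y & p = (s0, (false, rho r))))) <-> x = y.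
  have [[s [n [Gs sn]]]|nx] := pselect (exists s n, G s /\ s n = x).
    exists (s, (true, n)); split=> // y; split.
      move=> [_ [-> [[m /= sm [nm]]|[r _ []//]]]].
      by rewrite -sn nm.
    by move=> <-; exists (s, (true, n)); split => //; left; exists n.
  exists (s0, (false, rho (exist _ x nx))); split=> // y; split.
    by move=> [_ [-> [[//]|[r <- [/rhoI <-]]]]].
  by move=> <-; eexists; split; first reflexivity; right; exists (exist _ x nx).
have [f Ff] := choice F.
have fI : injective f.
  move=> x y fxy; apply/(Ff x).2; rewrite fxy; apply/(Ff y).2; exact: erefl.
exists (fun p => (f p.1).1 (pickle ((f p.1).2, p.2))) => -[x k] [y l] /= e.
have [] := PG _ _ (Ff x).1 (Ff y).1 _ _ e.
move=> e1 /(pcan_inj pickleK)[e2 ->]; congr (_, _); apply: fI.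
by case: (f x) (f y) e1 e2 => ? ? [? ?] /= -> ->.
Qed.

Lemma emb_strict A B : emb A B -> ~ emb B A -> emb (option A) B.
Proof.
move=> [f fI] nBA.
have [b nb] : exists b, ~ exists a, f a = b.
  apply: contrapT => /forallNP h; apply: nBA.
  have /choice[g gK] : forall b, exists a, f a = b by move=> b; exact: contrapT.
  by exists g; exact: can_inj gK.
exists (oapp f b) => -[x|] [y|] //=; first by move/fI->.
- by move=> e; case: nb; exists x.
- by move=> e; case: nb; exists y.
Qed.

(** The point sent to [None], if any, is rerouted to the image of [None]. *)
Lemma emb_option_inv A B : emb (option A) (option B) -> emb A B.
Proof.
move=> [f fI].
have F (x : A) : exists y,
    f (Some x) = Some y \/ (f (Some x) = None /\ f None = Some y).
  case e : (f (Some x)) => [y|]; first by exists y; left.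
  case e2 : (f None) => [y|]; first by exists y; right.
  by move: e; rewrite -e2 => /fI.
have [g gP] := choice F; exists g => x y e.
have := gP y; rewrite -e; have [ex|[ex ex']] := gP x => -[ey|[ey ey']].
- by move: ex; rewrite -ey => /fI[].
- by move: ex; rewrite -ey' => /fI.
- by move: ex'; rewrite -ey => /fI.
- by move: ex; rewrite -ey => /fI[].
Qed.

Lemma emb_option_nat A : emb (option A) A -> emb nat A.
Proof.
move=> [f fI]; exists (fun n => iter n (f \o some) (f None)).
elim=> [|n IHn] [|m] //=; [by move/fI|by move/fI|].
by move=> /fI[]/IHn->.
Qed.

Lemma emb_nat_prod_bool A : emb nat (A * bool) -> emb nat A.
Proof.
move=> /card_le_embP nA2; apply/card_le_embP; apply: contrapT => /finite_setPn finA.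
apply: infinite_nat; apply: card_le_finite nA2 _.
have -> : [set: A * bool] = [set: A] `*` [set: bool] by apply/seteqP; split.
by apply: finite_setX => //; exact: finite_finset.
Qed.

(** If both embeddings fail, each of [I1] and [I0] has room for one point more than its part of I,
    so [option I] receives two points more than I has. This forces I to be infinite; then the larger
    part absorbs [option I], hence also [I0] or [I1], a contradiction. *)
Lemma split_additive I I0 I1 (S : set I) :
  [set: option I] #= [set: (I0 + I1)%type] ->
  emb I1 {i | S i} \/ emb I0 {i | ~ S i}.
Proof.
rewrite card_eq_le => /andP[/card_le_embP IS /card_le_embP SI].
apply: contrapT => /not_orP[n1 n0].
set X := ({i | S i}) in n1 *; set Y := ({i | ~ S i}) in n0 *.
have oX : emb (option X) I1 by apply: emb_strict => //; case: (emb_total X I1).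
have oY : emb (option Y) I0 by apply: emb_strict => //; case: (emb_total Y I0).
have [iX iXI] : emb (option X) I1 := oX; have [iY iYI] : emb (option Y) I0 := oY.
have [j jI] : emb I (X + Y).
  exists (fun i => match pselect (S i) with
    left h => inl (exist _ i h) | right h => inr (exist _ i h) end).
  by move=> x y; case: pselect => ?; case: pselect => ? // [].
have infXY : emb nat (X + Y).
  apply: emb_option_nat; apply: emb_option_inv.
  have [g gI] := SI.
  exists (fun z => omap j (g (match z with
    None => inr (iX None) | Some None => inl (iY None)
    | Some (Some (inl x)) => inr (iX (Some x))
    | Some (Some (inr y)) => inl (iY (Some y)) end))) => z z' /(inj_omap jI)/gI.
  by case: z => [[[x|y]|]|]; case: z' => [[[x'|y']|]|] // [];
    (move=> /iXI || move=> /iYI) => // -[->].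
have IXY I' : emb I' (I0 + I1) -> emb I' (option (X + Y)).
  move=> /emb_trans; apply; apply: emb_trans SI _.
  by exists (omap j); exact: inj_omap.
have absorb Z : emb X Z -> emb Y Z -> emb (option (X + Y)) Z.
  move=> [f fI] [g gI].
  have infZ : emb nat Z.
    apply: emb_nat_prod_bool; apply: emb_trans infXY _.
    exists (fun z => match z with inl x => (f x, true) | inr y => (g y, false) end).
    by move=> [x|y] [x'|y'] // []; [move/fI->|move/gI->].
  apply: emb_trans (emb_prod_nat infZ); have [s sI] := infZ.
  exists (fun z => match z with
    None => (s 0, 0) | Some (inl x) => (f x, 1) | Some (inr y) => (g y, 2) end).
  by move=> [[x|y]|] [[x'|y']|] // []; [move/fI->|move/gI->].
have id_emb Z : emb Z Z by exists id.
have [XY|YX] := emb_total X Y.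
  apply: n0; apply: emb_trans (absorb _ XY (id_emb _)); apply: IXY.
  by exists inl => ? ? [].
apply: n1; apply: emb_trans (absorb _ (id_emb _) YX); apply: IXY.
by exists inr => ? ? [].
Qed.

(** J serves only as an infinite set below K, which settles the case of countable I. *)
Lemma small_prod_nat I J K : card_lt I K -> card_lt J K -> emb nat J ->
  card_lt (I * nat) K.
Proof.
move=> IK JK natJ.
have [/emb_prod_nat II|] := pselect (emb nat I); first exact: emb_card_lt IK.
move=> /card_le_embP/finite_setPn/finite_set_countable.
move=> /(countableX (countableP [set: nat])).
have -> : [set: nat] `*` [set: I] = [set: nat * I] by apply/seteqP; split.
move=> /card_le_embP natI; apply: emb_card_lt JK; apply: emb_trans natJ.
by apply: emb_trans natI; exists (fun p => (p.2, p.1)) => -[x y] [x' y'] /= [-> ->].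
Qed.

(** * Definable relations *)

Notation In := List.In.

Lemma In_mem (T : eqType) (x : T) s : In x s <-> x \in s.
Proof.
elim: s => //= y s IHs; rewrite inE; split.
  by move=> [->|/IHs ->]; rewrite ?eqxx ?orbT.
by move=> /orP[/eqP->|/IHs]; [left|right].
Qed.

Lemma In_cat T (x : T) s t : In x (s ++ t) <-> In x s \/ In x t.
Proof. exact: List.in_app_iff. Qed.

Lemma In_flatten_map A T (g : A -> seq T) (e : seq A) a x :
  In a e -> In x (g a) -> In x (flatten (map g e)).
Proof.
elim: e => //= b e IHe [->|ae] xa; apply/In_cat; first by left.
by right; exact: IHe.
Qed.

(** The map [idx] is chosen before the structure and the assignment, so it can rename a formula once
    and for all. The extra index is where variables outside s go. *)
Lemma index_list V (s : seq V) : exists idx : V -> 'I_(size s).+1,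
  forall (N : Type) (pt : N) (v : V -> N), exists v' : 'I_(size s).+1 -> N,
    forall x, In x s -> v' (idx x) = v x.
Proof.
exists (fun x => inord (@index {classic V} x s)) => N pt v.
exists (fun k => nth pt (map v s) k) => x /(@In_mem {classic V}) xs.
have lt : (@index {classic V} x s < size s)%N by rewrite index_mem.
by rewrite inordK ?(nth_map (x : {classic V})) ?nth_index// ltnS ltnW.
Qed.

Section Definability.
Variable L : language.
Implicit Types (N : structure L).

Lemma teval_trename N V W (h : V -> W) (t : term L V) (w : W -> N) :
  teval w (trename h t) = teval (w \o h) t.
Proof. by elim: t => //= f args IH; congr finterp; apply/funext => k. Qed.

Lemma sat_frename N V W (h : V -> W) (phi : formula L V) (w : W -> N) :
  sat (frename h phi) w <-> sat phi (w \o h).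
Proof.
elim: phi W h w => {V} [V s t|V r args|V phi IH|V phi IH1 psi IH2|V phi IH] W h w /=.
- by rewrite !teval_trename.
- by under eq_fun do rewrite teval_trename.
- by rewrite IH.
- by rewrite IH1 IH2.
- split=> -[a]; [move/IH => H|move=> H]; exists a; [|apply/IH]; move: H;
  by have -> : (fun o => oapp w a o) \o omap h = (fun o => oapp (w \o h) a o)
    by apply/funext => -[].
Qed.

Lemma term_support V (t : term L V) : exists s : seq V,
  forall N (v v' : V -> N), (forall x, In x s -> v x = v' x) ->
    teval v t = teval v' t.
Proof.
elim: t => [x|f args IH]; first by exists [:: x] => N v v' /(_ x)/=; apply; left.
have [g gP] := choice IH; exists (flatten (map g (enum 'I_(farity f)))) => N v v' e /=.
congr finterp; apply/funext => k; apply: gP => x xk; apply: e.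
by apply: (In_flatten_map (a := k)) => //; apply/In_mem; rewrite mem_enum.
Qed.

Lemma formula_support V (phi : formula L V) : exists s : seq V,
  forall N (v v' : V -> N), (forall x, In x s -> v x = v' x) ->
    (sat phi v <-> sat phi v').
Proof.
elim: phi => {V} [V t1 t2|V r args|V phi IH|V phi [s1 s1P] psi [s2 s2P]|V phi [s sP]].
- have [s1 s1P] := term_support t1; have [s2 s2P] := term_support t2.
  exists (s1 ++ s2) => N v v' e /=.
  rewrite (s1P _ v v') ?(s2P _ v v')// => x xs; apply/e/In_cat; [by right|by left].
- have [g gP] := choice (fun k => term_support (args k)).
  exists (flatten (map g (enum 'I_(rarity r)))) => N v v' e /=.
  suff -> : (fun k => teval v (args k)) = (fun k => teval v' (args k)) by [].
  apply/funext => k; apply: gP => x xk; apply: e.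
  by apply: (In_flatten_map (a := k)) => //; apply/In_mem; rewrite mem_enum.
- by have [s sP] := IH; exists s => N v v' /sP/= ->.
- exists (s1 ++ s2) => N v v' e /=.
  by rewrite (s1P _ v v') ?(s2P _ v v')// => x xs; apply/e/In_cat; [right|left].
- exists (pmap id s) => N v v' e /=.
  suff H a : sat phi (fun o => oapp v a o) <-> sat phi (fun o => oapp v' a o).
    by split=> -[a /H]; exists a.
  apply: sP => -[x|//] xs /=; apply: e.
  by elim: s xs => //= -[y|] s IHs [//[->]|]; [left|right; exact: IHs|exact: IHs].
Qed.

(* The defining formula is uniform in N, so that definable relations transfer along
   elementary embeddings. *)
Definition definable V (P : forall N, (V -> N) -> Prop) :=
  exists theta : formula L V, forall N v, sat theta v <-> P N v.

Lemma definable_iff V (P Q : forall N, (V -> N) -> Prop) :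
  (forall N v, P N v <-> Q N v) -> definable P -> definable Q.
Proof. by move=> PQ [theta tP]; exists theta => N v; rewrite tP. Qed.

Lemma definable_sat V (phi : formula L V) : definable (fun N v => sat phi v).
Proof. by exists phi. Qed.

Lemma definable_not V (P : forall N, (V -> N) -> Prop) :
  definable P -> definable (fun N v => ~ P N v).
Proof. by move=> [theta tP]; exists (FNeg theta) => N v /=; rewrite tP. Qed.

Lemma definable_and V (P Q : forall N, (V -> N) -> Prop) :
  definable P -> definable Q -> definable (fun N v => P N v /\ Q N v).
Proof. by move=> [t tP] [u uQ]; exists (FAnd t u) => N v /=; rewrite tP uQ. Qed.

Lemma definable_imp V (P Q : forall N, (V -> N) -> Prop) :
  definable P -> definable Q -> definable (fun N v => P N v -> Q N v).
Proof.
move=> dP dQ; apply: definable_iff (definable_not (definable_and dP (definable_not dQ))).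
move=> N v; split=> [nPQ p|PQ [/PQ]//].
by apply: contrapT => q; apply: nPQ.
Qed.

Lemma definable_const V (b : Prop) : definable (fun N (v : V -> N) => b).
Proof.
pose T : formula L V := FEx (FEq (Var L None) (Var L None)).
have [h|h] := pselect b; [exists T|exists (FNeg T)] => N v /=.
  by split=> // _; have [a] := carrier_inhabited N; exists a.
by split=> // nT; case: nT; have [a] := carrier_inhabited N; exists a.
Qed.

Lemma definable_iffb V (P Q : forall N, (V -> N) -> Prop) :
  definable P -> definable Q -> definable (fun N v => P N v <-> Q N v).
Proof.
move=> dP dQ.
by apply: definable_iff (definable_and (definable_imp dP dQ) (definable_imp dQ dP)).
Qed.

Lemma definable_all V A (s : seq A) (P : A -> forall N, (V -> N) -> Prop) :
  (forall a, definable (P a)) ->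
  definable (fun N v => forall a, In a s -> P a N v).
Proof.
move=> dP; elim: s => [|a s IHs].
  by apply: definable_iff (definable_const _ True).
apply: definable_iff (definable_and (dP a) IHs) => N v /=.
split=> [[Pa Ps] b [<-//|/Ps//]|Ps]; first by split; [apply: Ps; left|move=> b bs; apply: Ps; right].
Qed.

Lemma definable_comp V W (h : V -> W) (P : forall N, (V -> N) -> Prop) :
  definable P -> definable (fun N (w : W -> N) => P N (w \o h)).
Proof.
by move=> [t tP]; exists (frename h t) => N w; rewrite sat_frename.
Qed.

Lemma definable_exists_tuple n V (phi : formula L ('I_n + V)) :
  definable (fun N w => exists u : 'I_n -> N, sat phi (assign u w)).
Proof.
elim: n V phi => [|n IHn] V phi.
  exists (frename (fun z => match z with
    inl k => match notF (ltn_ord (k : 'I_0)) with end | inr x => x end) phi) => N w.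
  rewrite sat_frename; split=> [H|[u]].
    exists (fun k => match notF (ltn_ord (k : 'I_0)) with end).
    by congr (sat phi _) : H; apply/funext => -[[]|].
  by congr (sat phi _); apply/funext => -[[]|].
pose sh (z : 'I_n.+1 + V) : option ('I_n + V) := match z with
  inl k => omap inl (unlift ord0 k) | inr x => Some (inr x) end.
apply: definable_iff (IHn _ (FEx (frename sh phi))) => N w.
have E (u : 'I_n -> N) a : (fun o => oapp (assign u w) a o) \o sh =
    assign (fun k => oapp u a (unlift ord0 k)) w.
  by apply/funext => -[k|x] //=; case: unlift.
split=> [[u [a /sat_frename]]|[u H]].
  by rewrite E => H; eexists; exact: H.
exists (u \o lift ord0), (u ord0); apply/sat_frename; rewrite E.
congr (sat phi (assign _ w)) : H; apply/funext => k.
by case: unliftP => [j ->|->].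
Qed.

(* Existential quantification over all of [V -> N] is first order: by finite support only
   finitely many of the values v z matter.  The entries v z with [f z = Some z'] are
   prescribed by w. *)
Lemma definable_ex V W (f : V -> option W) (P : forall N, (V -> N) -> Prop) :
  definable P ->
  definable (fun N (w : W -> N) => exists2 v : V -> N,
    (forall z z', f z = Some z' -> v z = w z') & P N v).
Proof.
move=> [theta tP]; have [s sP] := formula_support theta.
have [idx idxP] := index_list s.
pose r z : 'I_(size s).+1 + W := if f z is Some w then inr w else inl (idx z).
apply: definable_iff (definable_exists_tuple (frename r theta)) => N w.
split=> [[u /sat_frename H]|[v fv /tP H]].
  by exists (assign u w \o r); [move=> z z' fz; rewrite /= /r fz|apply/tP].
have [pt] := carrier_inhabited N.
have [u uP] := idxP N pt v; exists u; apply/sat_frename.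
apply: (sP N v _ _).1 H => z zs; rewrite /= /r; case e : (f z) => [z'|] /=; first exact: fv.
by rewrite uP.
Qed.

Lemma elementary_embedding_sat (M N : structure L) (f : M -> N) :
  elementary_embedding f -> forall V (phi : formula L V) (v : V -> M),
  sat phi v <-> sat phi (f \o v).
Proof.
move=> ef V phi v; have [s sP] := formula_support phi.
have [idx idxP] := index_list s.
have [pt] := carrier_inhabited M; have [v' v'P] := idxP M pt v.
have E1 : sat phi v <-> sat phi (v' \o idx) by apply: sP => x /v'P/= ->.
have E2 : sat phi (f \o v) <-> sat phi ((f \o v') \o idx) by apply: sP => x /v'P/= ->.
have E3 := sat_frename idx phi v'; have E4 := sat_frename idx phi (f \o v').
by have := ef _ (frename idx phi) v'; tauto.
Qed.

End Definability.

(** * Saturation for infinitely many variables *)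

Lemma finite_preimage_list A T (t : A -> T) (S : set T) :
  S `<=` range t -> finite_set S ->
  exists l : seq A, forall x, S x -> exists2 a, In a l & t a = x.
Proof.
move=> St /(@finite_seqP {classic T})[s Ss].
have {Ss}: forall x, S x -> In x s by move=> x; rewrite Ss => /(@In_mem {classic T}).
elim: s S St => [|y s IHs] S St sub; first by exists [::] => x /sub.
have [|x [Sx xy]|l lP] := IHs (S `\ y).
- by move=> x [/St].
- by have [/esym|] := sub x Sx.
have [[a _ ay]|ny] := pselect (range t y).
  exists (a :: l) => x Sx; have [->|xy] := pselect (x = y); first by exists a => //; left.
  by have [|b bl bx] := lP x; [split|exists b => //; right].
exists l => x Sx; apply: lP; split=> // xy; apply: ny.
by rewrite -xy; exact: St.
Qed.

Section Saturation.
Variables (L : language) (K : Type) (M : structure L).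
Hypothesis Msat : saturated K M.

(* Zorn on the graphs of partial realizations extending g0 on D0 that stay finitely
   satisfiable: a missing variable is a type over the fewer than K values already chosen. *)
Lemma realize V (D0 : set V) (g0 : V -> M) A
    (Q : A -> forall N : structure L, (V -> N) -> Prop) :
  card_lt V K -> (forall a, definable (Q a)) ->
  (forall l : seq A, exists2 v : V -> M,
     forall z, D0 z -> v z = g0 z & forall a, In a l -> Q a M v) ->
  exists2 v : V -> M, forall z, D0 z -> v z = g0 z & forall a, Q a M v.
Proof.
move=> VK dQ finQ.
pose P (G : set (V * M)) := forall l : seq A, exists v : V -> M,
  [/\ forall z, D0 z -> v z = g0 z, forall p, G p -> v p.1 = p.2 &
      forall a, In a l -> Q a M v].
have P0 : P set0 by move=> l; have [v v0 vl] := finQ l; exists v; split.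
have [G [PG maxG]] : exists G, P G /\ forall H, G `<` H -> ~ P H.
  apply: Zorn_bigcup => F FP Ftot l.
  set U := \bigcup_(X in F) X.
  have Ufun z m m' : U (z, m) -> U (z, m') -> m = m'.
    move=> [X FX Xm] [Y FY Ym].
    have [XY|YX] := Ftot _ _ FX FY.
      by have [v [_ vY _]] := FP _ FY [::]; rewrite -[m'](vY _ Ym) -[m](vY _ (XY _ Xm)).
    by have [v [_ vX _]] := FP _ FX [::]; rewrite -[m'](vX _ (YX _ Ym)) -[m](vX _ Xm).
  (* The conditions in l see finitely many variables, so one member X of the chain already
     prescribes every value of the union that matters to them. *)
  have [theta tP] := definable_all l dQ; have [s sP] := formula_support theta.
  have [X FX sX] : exists2 X, F X \/ X = set0 &
      forall z m, In z s -> U (z, m) -> X (z, m).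
    elim: {sP}s => [|x s [X FX XP]]; first by exists set0; [right|].
    have [[m [Y FY Ym]]|nU] := pselect (exists m, U (x, m)); last first.
      exists X => // z m [<- Um|]; last exact: XP.
      by case: nU; exists m.
    have Yx m' : U (x, m') -> Y (x, m').
      by move=> Um'; rewrite (Ufun x m' m)//; exists Y.
    have [FX'|X0] := FX; last first.
      exists Y; first by left.
      by move=> z m' [<-/Yx//|zs /(XP _ _ zs)]; rewrite X0.
    have [XY|YX] := Ftot _ _ FX' FY.
      exists Y; first by left.
      by move=> z m' [<-/Yx//|zs /(XP _ _ zs)/XY].
    exists X => // z m' [<-/Yx/YX//|]; exact: XP.
  have PX : P X by case: FX => [/FP|->].
  have [v [v0 vX vl]] := PX l.
  have /choice[u uP] : forall z, exists y, (forall m, U (z, m) -> y = m) /\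
      ((~ exists m, U (z, m)) -> y = v z).
    move=> z.
    have [[m Um]|nU] := pselect (exists m, U (z, m)).
      by exists m; split=> [m' /(Ufun _ _ _ Um)//|]; case; exists m.
    by exists (v z); split=> // m Um; case: nU; exists m.
  exists u; split.
  - move=> z Dz; have [[m Um]|nU] := pselect (exists m, U (z, m)); last first.
      by rewrite (uP z).2// v0.
    rewrite ((uP z).1 _ Um); case: Um => Y FY Ym.
    by have [w [w0 wY _]] := FP _ FY [::]; rewrite -[m](wY _ Ym) w0.
  - by move=> [z m] Um; exact: (uP z).1.
  - apply/tP; apply: (sP _ v u _).1; last exact/tP.
    move=> z zs; have [[m Um]|nU] := pselect (exists m, U (z, m)); last first.
      by rewrite (uP z).2.
    by rewrite ((uP z).1 _ Um); exact: (vX (z, m) (sX _ _ zs Um)).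
pose dom z m := D0 z /\ g0 z = m \/ G (z, m).
have dom_total z : exists m, dom z m.
  apply: contrapT => nz.
  pose B : set M := [set m | exists z, dom z m].
  have BK : card_lt B K.
    apply: emb_card_lt VK.
    have /choice[c cP] : forall b : B, exists z, dom z (val b).
      by move=> b; have := set_mem (valP b).
    exists c => b b' e; apply: val_inj; have := cP b'; rewrite -e => d'.
    have [v [v0 vG _]] := PG [::].
    have vd z' m : dom z' m -> v z' = m by move=> [[Dz <-]|/vG//]; exact: v0.
    by rewrite -(vd _ _ (cP b)) -(vd _ _ d').
  (* z becomes the variable of the type, variables with a prescribed value become constants from B,
     and all others are quantified existentially. *)
  pose f y : option ('I_1 + B) := if pselect (y = z) is left _ then Some (inl ord0)
    else if pselect (exists m, dom y m) is left h then
      Some (inr (SigSub (mem_set (ex_intro _ y (projT2 (cid h)) : B (projT1 (cid h))))))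
    else None.
  have /choice[t tP] l := definable_ex f (definable_all l dQ).
  have [S0|a aP] := Msat BK (S := range t).
    move=> S0t /(finite_preimage_list S0t)[ls lsP].
    have [v [v0 vG vl]] := PG (flatten ls).
    have vd y m : dom y m -> v y = m by move=> [[Dz <-]|/vG//]; exact: v0.
    exists (fun=> v z) => phi /lsP[l lls <-]; apply/tP; exists v.
      move=> y y'; rewrite /f; case: pselect => [-> [<-]//|_].
      case: pselect => // h [<-] /=; apply: vd; exact: (projT2 (cid h)).
    move=> b bl; apply: vl.
    elim: ls lls {lsP} => //= l' ls IH [e|/IH lP]; apply/In_cat; last by right.
    by left; rewrite e.
  apply: (maxG (G `|` [set (z, a ord0)])).
    split=> [p Gp|sub]; first by left.
    by apply: nz; exists (a ord0); right; apply: sub; right.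
  move=> l; have [|v fv vl] := (tP l M (assign a val)).1; first by apply: aP; exists l.
  have vd y m : dom y m -> v y = m.
    move=> d; have := fv y; rewrite /f; case: pselect => [e|_].
      by case: nz; exists m; rewrite -e.
    case: pselect => [h|[]]; last by exists m.
    move=> /(_ _ erefl) -> /=; case: cid => m' /= d'.
    have [w [w0 wG _]] := PG [::].
    have wd y' n : dom y' n -> w y' = n by move=> [[Dz <-]|/wG//]; exact: w0.
    by rewrite -(wd _ _ d') -(wd _ _ d).
  exists v; split=> //.
  - by move=> y Dy; apply: vd; left.
  - move=> [y m] [Gy|[-> ->]] /=; first by apply: vd; right.
    by rewrite (fv z (inl ord0))// /f; case: pselect.
have [v [v0 vG _]] := PG [::]; exists v => // a.
have [u [u0 uG /(_ a (or_introl erefl))]] := PG [:: a].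
suff -> : u = v by [].
apply/funext => z; have [m [[Dz _]|Gm]] := dom_total z; first by rewrite u0 ?v0.
by rewrite (uG _ Gm) (vG _ Gm).
Qed.

End Saturation.

(** * Ramsey's theorem *)

Definition incr (f : nat -> nat) : Prop := forall x y, x < y -> f x < f y.

Lemma incr_comp f g : incr f -> incr g -> incr (f \o g).
Proof. by move=> fi gi x y /gi/fi. Qed.

Lemma incr_id : incr id. Proof. by []. Qed.

Lemma incr_step f : (forall n, f n < f n.+1) -> incr f.
Proof. by move=> fS x y; apply: (homo_ltn (r := fun m n => m < n)) => //; exact: ltn_trans. Qed.

Lemma incr_enum (C : nat -> Prop) : (forall m, exists2 i, m <= i & C i) ->
  exists2 s, incr s & forall k, C (s k).
Proof.
move=> CP; have /choice[f fP] : forall m, exists i, m <= i /\ C i.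
  by move=> m; have [i] := CP m; exists i.
exists (fun k => iter k (f \o S) (f 0)).
  by apply: incr_step => n; exact: (fP _).1.
by case=> [|k]; exact: (fP _).2.
Qed.

(** Since Q reads only the first n terms, on increasing sequences it is a two-colouring of the
    n-element sets of naturals; h enumerates a homogeneous set. *)
Lemma ramsey n (Q : (nat -> nat) -> Prop) :
  (forall g g', (forall k, k < n -> g k = g' k) -> Q g -> Q g') ->
  exists2 h, incr h & forall g, incr g -> (Q (h \o g) <-> Q h).
Proof.
elim: n Q => [|n IHn] Q Qdep.
  by exists id => // g _; split; exact: Qdep.
pose cons (a : nat) (g : nat -> nat) k := if k is k'.+1 then g k' else a.
(* [nxt] thins out a sequence behind its first term until Q no longer depends on the later terms.
   Along the diagonal [a], the colour then depends on the first term alone. *)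
have /choice[nxt nxtP] : forall k : nat -> nat, exists k', exists2 h, incr h &
    k' = k \o S \o h /\
    forall g, incr g -> (Q (cons (k 0) (k' \o g)) <-> Q (cons (k 0) k')).
  move=> k; have [|h hi hP] := IHn (fun g => Q (cons (k 0) (k \o S \o g))).
    move=> g g' e; apply: Qdep => -[//|j] jn /=.
    by rewrite e.
  by exists (k \o S \o h), h.
pose ks i := iter i nxt id.
have ks_incr i : incr (ks i).
  elim: i => //= i IHi; have [h hi [-> _]] := nxtP (ks i).
  by apply: incr_comp => //; apply: incr_comp.
have ks_sub i j : i <= j -> exists2 u, incr u & ks j = ks i \o u.
  move=> /subnKC<-; elim: (j - i) => [|k [u ui ku]]; first by exists id; rewrite ?addn0.
  rewrite addnS; have [h hi [e _]] := nxtP (ks (i + k)).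
  exists (u \o S \o h); first by apply: incr_comp => //; apply: incr_comp.
  by rewrite [LHS]/= -/(ks _) e ku.
pose a i := ks i 0.
have a_incr : incr a.
  apply: incr_step => i; rewrite /a /=; have [h hi [-> _]] := nxtP (ks i).
  exact: ks_incr.
pose color i := Q (cons (ks i 0) (ks i.+1)).
have aQ s : incr s -> (Q (a \o s) <-> color (s 0)).
  move=> si.
  have /choice[g gP] : forall x, exists y, a (s x.+1) = ks (s 0).+1 y.
    move=> x; have [|u _ e] := ks_sub (s 0).+1 (s x.+1); first exact: si.
    by exists (u 0); rewrite /a e.
  have gi : incr g.
    move=> x y xy; rewrite ltnNge; apply/negP => gyx.
    have : a (s y.+1) <= a (s x.+1).
      rewrite !gP; move: gyx; rewrite leq_eqVlt => /orP[/eqP->//|].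
      by move/(ks_incr (s 0).+1)/ltnW.
    by apply/negP; rewrite -ltnNge; apply/a_incr/si.
  have [h _ [_ /(_ g gi)]] := nxtP (ks (s 0)).
  suff -> : cons (ks (s 0) 0) (nxt (ks (s 0)) \o g) = a \o s by [].
  by apply/funext => -[//|x] /=; rewrite gP.
have [/incr_enum[s si sC]|] := pselect (forall m, exists2 i, m <= i & color i).
  exists (a \o s); first exact: incr_comp.
  move=> g gi; rewrite aQ// -compA aQ; last exact: incr_comp.
  by split=> _; exact: sC.
move=> /existsNP[m mC].
have nC i : m <= i -> ~ color i by move=> mi Ci; apply: mC; exists i.
have mi : incr (addn m) by move=> x y; rewrite ltn_add2l.
exists (a \o addn m); first exact: incr_comp.
move=> g gi; rewrite aQ// -compA aQ; last exact: incr_comp.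
by split=> C; exfalso; apply: nC C; exact: leq_addr.
Qed.

Section Extend.
Variables (J : eqType) (lt : rel J).
Hypothesis lt_total : forall x y, [|| lt x y, x == y | lt y x].

(** The last two hypotheses say that the displacement g - f is nonnegative and nondecreasing. Its
    running maximum, added to n, therefore gives an increasing map taking the right value at each
    [f x]. *)
Lemma extend_incr (X : seq J) (f g : J -> nat) :
  {in X &, forall x y, lt x y -> f x < f y} ->
  {in X, forall x, f x <= g x} ->
  {in X &, forall x y, lt x y -> f y + g x <= g y + f x} ->
  exists2 h, incr h & {in X, forall x, h (f x) = g x}.
Proof.
move=> fi fg gap; pose h n := n + \max_(x <- X | f x <= n) (g x - f x).
exists h.
  move=> n n' nn'; rewrite /h -addSn leq_add//.
  apply/bigmax_leqP_seq => x xX fx.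
  by apply: (leq_bigmax_seq (F := fun x => g x - f x) x) => //; exact: leq_trans fx (ltnW _).
move=> x xX; rewrite /h; suff -> : \max_(y <- X | f y <= f x) (g y - f y) = g x - f x.
  by rewrite subnKC// fg.
apply/eqP; rewrite eqn_leq (leq_bigmax_seq (F := fun x => g x - f x) x)// andbT.
apply/bigmax_leqP_seq => y yX fyx.
have /or3P[xy|/eqP->//|yx] := lt_total x y.
  by move: (fi _ _ xX yX xy); rewrite ltnNge fyx.
have := gap _ _ yX xX yx; have := fg _ xX; have := fg _ yX; lia.
Qed.

End Extend.

(** * Mutually indiscernible arrays *)

Section Array.
Variables (I : Type) (m : I -> nat).

(** A cell is a row, a column and a coordinate. Cells serve as variables, so a whole array of tuples
    of varying lengths is a single assignment. *)
Definition cell (J : Type) : Type := {i : I & (J * 'I_(m i))%type}.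
Definition row J (z : cell J) : I := projT1 z.
Definition col J (z : cell J) : J := (projT2 z).1.

Definition reindex J J' (h : I -> J -> J') (z : cell J) : cell J' :=
  existT _ (projT1 z) (h (projT1 z) (projT2 z).1, (projT2 z).2).

Lemma reindex_comp J J' J'' (h : I -> J' -> J'') (k : I -> J -> J') :
  reindex h \o reindex k = reindex (fun i => h i \o k i).
Proof. by []. Qed.

Lemma emb_cell J : emb J nat -> emb (cell J) (I * nat).
Proof.
move=> [f fI]; exists (fun z => (row z, pickle (f (col z), val (projT2 z).2))).
move=> [i [j k]] [i' [j' k']] [e]; case: i' / e k' => k'.
by move=> /(pcan_inj pickleK)[]; rewrite /col /= => /fI-> /val_inj->.
Qed.

End Array.

Section Indiscernible.
Variables (L : language) (K : Type) (M : structure L).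
Hypothesis Msat : saturated K M.
Variables (I : Type) (m : I -> nat).
Hypothesis small_array : card_lt (I * nat) K.

Notation var := (cell m).

(* Indiscernibility of the rows in R, mutually and over all other rows. *)
Definition indisc (R : I -> Prop) (b : var nat -> M) : Prop :=
  forall (theta : formula L (var nat)) h, (forall i, incr (h i)) ->
    (forall i, ~ R i -> h i = id) -> (sat theta b <-> sat theta (b \o reindex h)).

(* b' realizes the Ehrenfeucht-Mostowski type of b. *)
Definition based_on (b b' : var nat -> M) : Prop :=
  forall theta : formula L (var nat),
    (forall h, (forall i, incr (h i)) -> sat theta (b \o reindex h)) -> sat theta b'.

Lemma reindex_id (b : var nat -> M) : b \o reindex (fun=> id) = b.
Proof. by apply/funext => -[i [j k]]. Qed.

Lemma based_on_refl b : based_on b b.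
Proof.
move=> theta /(_ (fun=> id)); rewrite reindex_id; apply=> _; exact: incr_id.
Qed.

Lemma based_on_trans b1 b2 b3 :
  based_on b1 b2 -> based_on b2 b3 -> based_on b1 b3.
Proof.
move=> b12 b23 theta tb1; apply: b23 => h hi; apply/(sat_frename (reindex h))/b12 => k ki.
apply/sat_frename; rewrite -compA reindex_comp; apply: tb1 => i.
exact: incr_comp.
Qed.

Definition at_row (i0 : I) (g : nat -> nat) (i : I) : nat -> nat :=
  if pselect (i = i0) then g else id.

Lemma at_row_incr i0 g i : incr g -> incr (at_row i0 g i).
Proof. by move=> gi; rewrite /at_row; case: pselect => /= [_|_] //; exact: incr_id. Qed.

Lemma col_bound (s : seq (var nat)) : exists n, forall z, In z s -> col z < n.
Proof.
elim: s => [|z s [n nP]]; first by exists 0.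
exists (maxn n (col z).+1) => y /= [->|/nP yn]; first exact: leq_maxr.
exact: leq_trans yn (leq_maxl _ _).
Qed.

(** One use of Ramsey per formula, with n above all columns in its support; a further subsequence
    keeps the formulas already treated homogeneous. *)
Lemma homogeneous_row (b : var nat -> M) i0 (l : seq (formula L (var nat))) :
  exists2 h, incr h & forall theta, In theta l -> forall g, incr g ->
    (sat theta (b \o reindex (at_row i0 (h \o g))) <-> sat theta (b \o reindex (at_row i0 h))).
Proof.
elim: l => [|theta l [h hi hP]]; first by exists id.
have [s sP] := formula_support theta; have [n nP] := col_bound s.
have [|k ki kP] := @ramsey n (fun g => sat theta (b \o reindex (at_row i0 (h \o g)))).
  move=> g g' e; apply: (sP _ _ _ _).1 => z /nP zn /=; congr b; rewrite /reindex /at_row.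
  by case: pselect => //= ?; rewrite e.
exists (h \o k); first exact: incr_comp.
move=> psi /= [<-|psil] g gi; first exact: kP.
rewrite (hP psi psil k ki) -(hP psi psil (k \o g))//; exact: incr_comp.
Qed.

(** By saturation finitely many requirements suffice, and thinning out the row [i0] meets these. It
    preserves indiscernibility in R because the rows of R were indiscernible over all other rows,
    including [i0]. *)
Lemma indisc_step (R : I -> Prop) (b : var nat -> M) i0 : ~ R i0 -> indisc R b ->
  exists2 b', based_on b b' & indisc (fun i => R i \/ i = i0) b'.
Proof.
move=> nR bR.
pose A1 := {theta : formula L (var nat) |
  forall h, (forall i, incr (h i)) -> sat theta (b \o reindex h)}.
pose A2 := {p : formula L (var nat) * (I -> nat -> nat) |
  (forall i, incr (p.2 i)) /\ forall i, ~ (R i \/ i = i0) -> p.2 i = id}.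
pose Q (a : A1 + A2) (N : structure L) (v : var nat -> N) := match a with
  | inl t => sat (sval t) v
  | inr p => sat (sval p).1 v <-> sat (sval p).1 (v \o reindex (sval p).2) end.
have [|||b' _ b'Q] := realize Msat (D0 := set0) (g0 := b) (Q := Q).
- by apply: emb_card_lt small_array; apply: emb_cell; exists id.
- move=> [t|p]; first exact: definable_sat.
  apply: definable_iffb; first exact: definable_sat.
  exact: (definable_comp _ (definable_sat _)).
- move=> l.
  have [h hi hP] := homogeneous_row b i0
    (pmap (fun a : A1 + A2 => if a is inr p then Some (sval p).1 else None) l).
  exists (b \o reindex (at_row i0 h)) => // -[[theta tP] _|[[theta k] /= [ki kR]] al] /=.
    by apply: tP => i; exact: at_row_incr.
  have {}hP : forall g, incr g -> (sat theta (b \o reindex (at_row i0 (h \o g))) <->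
      sat theta (b \o reindex (at_row i0 h))).
    apply: hP; elim: l al => //= a l IH [->|/IH] /=; first by left.
    by case: a => [?|?] //=; right.
  pose g := k i0; have gi : incr g by exact: ki.
  (* The action of k is split into its part on [i0], absorbed by h through homogeneity, and the rest
     [k'], absorbed by the indiscernibility of b. *)
  pose k' i := if pselect (i = i0) then id else k i.
  have -> : (b \o reindex (at_row i0 h)) \o reindex k =
      (b \o reindex k') \o reindex (at_row i0 (h \o g)).
    apply/funext => -[i [j e]]; rewrite /= /reindex /= /at_row /k'.
    by case: pselect => //= ei; rewrite /g -ei.
  rewrite -(hP g gi).
  have k'i i : incr (k' i) by rewrite /k'; case: pselect => /= _; [exact: incr_id|exact: ki].
  have k'R i : ~ R i -> k' i = id.
    by rewrite /k'; case: pselect => //= ii nRi; apply: (kR) => -[].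
  have := bR (frename (reindex (at_row i0 (h \o g))) theta) k' k'i k'R.
  have E1 := sat_frename (reindex (at_row i0 (h \o g))) theta b.
  have E2 := sat_frename (reindex (at_row i0 (h \o g))) theta (b \o reindex k').
  by tauto.
exists b'.
  by move=> theta tP; exact: (b'Q (inl (exist _ theta tP))).
move=> theta h hi hR; exact: (b'Q (inr (exist _ (theta, h) (conj hi hR)))).
Qed.

Lemma indisc_rows (b : var nat -> M) (rs : seq I) :
  exists2 b', based_on b b' & indisc (fun i => In i rs) b'.
Proof.
elim: rs => [|i rs [b1 bb1 b1P]].
  exists b; first exact: based_on_refl.
  move=> theta h _ hid; suff -> : h = fun=> id by rewrite reindex_id.
  by apply/funext => i; exact: hid.
have [irs|nirs] := pselect (In i rs).
  exists b1 => // theta h hi hR; apply: b1P => // j njrs; apply: hR => -[ij|//].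
  by apply: njrs; rewrite -ij.
have [b2 b12 b2P] := indisc_step nirs b1P; exists b2; first exact: based_on_trans b12.
by move=> theta h hi hR; apply: b2P => // j nj; apply: hR => -[ij|jrs]; apply: nj; [right|left].
Qed.

Section Index.
Variables (J : eqType) (lt : rel J).
Hypotheses (J_countable : emb J nat) (lt_irr : irreflexive lt)
  (lt_trans : transitive lt) (lt_total : forall x y, [|| lt x y, x == y | lt y x]).

(** A semantic substitute for bounding the free variables of [theta]; a reindexing then has to be
    increasing only on A. *)
Definition depends_on (A : I -> J -> Prop) (theta : formula L (var J)) : Prop :=
  forall v v' : var J -> M, (forall z, A (row z) (col z) -> v z = v' z) ->
    (sat theta v <-> sat theta v').

(* Two finite increasing placements of columns are compared through increasing self-maps
   of nat; this needs g to spread the columns at least as much as f. *)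
Lemma indisc_compare (b : var nat -> M) (s : seq (var J)) (theta : formula L (var J))
    (f g : I -> J -> nat) :
  indisc (fun i => In i (map (@row I m J) s)) b ->
  (forall v v' : var J -> M, (forall z, In z s -> v z = v' z) ->
    (sat theta v <-> sat theta v')) ->
  (forall z, In z s -> f (row z) (col z) <= g (row z) (col z)) ->
  (forall z z', In z s -> In z' s -> row z = row z' -> lt (col z) (col z') ->
    f (row z) (col z) < f (row z) (col z') /\
    f (row z) (col z') + g (row z) (col z) <= g (row z) (col z') + f (row z) (col z)) ->
  sat theta (b \o reindex f) <-> sat theta (b \o reindex g).
Proof.
move=> bI sP fg fgap.
pose X i := [seq col z | z <- s & `[< row z = i >]].
have XP i x : x \in X i -> exists z, [/\ In z s, row z = i & col z = x].
  move=> /In_mem/List.in_map_iff[z [zx /List.filter_In[zs /asboolP zi]]].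
  by exists z.
have /choice[h hP] : forall i, exists h, [/\ incr h,
    {in X i, forall x, h (f i x) = g i x} & ~ In i (map (@row I m J) s) -> h = id].
  move=> i; have [irs|nirs] := pselect (In i (map (@row I m J) s)); last first.
    exists id; split=> // x /XP[z [zs zi _]]; case: nirs; rewrite -zi.
    by apply/List.in_map_iff; exists z.
  have [|||h hi hX] := @extend_incr J lt lt_total (X i) (f i) (g i).
  - move=> x y /XP[z [zs zi zx]] /XP[z' [zs' zi' zx']] xy.
    by have [] := fgap z z' zs zs'; rewrite ?zi ?zi' ?zx ?zx'.
  - by move=> x /XP[z [zs zi zx]]; have := fg z zs; rewrite zi zx.
  - move=> x y /XP[z [zs zi zx]] /XP[z' [zs' zi' zx']] xy.
    by have [] := fgap z z' zs zs'; rewrite ?zi ?zi' ?zx ?zx'.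
  by exists h.
have E1 := sat_frename (reindex f) theta b.
have E2 := sat_frename (reindex f) theta (b \o reindex h).
have [|| E3 E3'] := bI (frename (reindex f) theta) h.
- by move=> i; have [] := hP i.
- by move=> i; have [] := hP i.
have E4 : sat theta ((b \o reindex h) \o reindex f) <-> sat theta (b \o reindex g).
  apply: sP => z zs /=; congr b; rewrite /reindex /=.
  have [_ hX _] := hP (row z); have := hX (col z); rewrite /row /col => -> //.
  apply/In_mem/List.in_map_iff; exists z; split=> //; apply/List.filter_In.
  by split=> //; apply/asboolP.
tauto.
Qed.

(** Counting the elements of X below a point works: x is counted for y but not for itself. *)
Lemma rank_exists (X : seq J) : exists e : J -> nat,
  forall x y, In x X -> lt x y -> e x < e y.
Proof.
exists (fun x => count (lt^~ x) X) => x y xX xy.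
have sub z : lt z x -> lt z y by move/lt_trans; apply.
elim: X xX => //= z X IHX [->|/IHX lt_c].
  rewrite xy lt_irr add0n add1n ltnS; exact: sub_count.
by rewrite -addnS leq_add//; case zx: (lt z x) => //; rewrite sub.
Qed.

Lemma bounded_on T (s : seq T) (f : T -> nat) : exists N, forall x, In x s -> f x <= N.
Proof.
elim: s => [|y s [N NP]]; first by exists 0.
exists (maxn (f y) N) => x /= [<-|/NP xN]; first exact: leq_maxl.
exact: leq_trans xN (leq_maxr _ _).
Qed.

(* Formulas true of all increasing finite subarrays of b hold of c; only finitely many rows
   matter for finite satisfiability, so the rows can be treated one at a time. *)
Lemma mutually_indiscernible (b : var nat -> M) : exists c : var J -> M,
  (forall (theta : formula L (var J)) (X : seq J),
     depends_on (fun _ x => In x X) theta ->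
     (forall f : I -> J -> nat,
        (forall i x y, In x X -> In y X -> lt x y -> f i x < f i y) ->
        sat theta (b \o reindex f)) ->
     sat theta c) /\
  (forall (theta : formula L (var J)) (A : I -> J -> Prop) (h : I -> J -> J),
     depends_on A theta ->
     (forall i x y, A i x -> A i y -> lt x y -> lt (h i x) (h i y)) ->
     (sat theta c <-> sat theta (c \o reindex h))).
Proof.
pose A1 := {p : formula L (var J) * seq J | depends_on (fun _ x => In x p.2) p.1 /\
  forall f : I -> J -> nat,
    (forall i x y, In x p.2 -> In y p.2 -> lt x y -> f i x < f i y) ->
    sat p.1 (b \o reindex f)}.
pose A2 := {p : formula L (var J) * (I -> J -> Prop) * (I -> J -> J) |
  depends_on p.1.2 p.1.1 /\
  forall i x y, p.1.2 i x -> p.1.2 i y -> lt x y -> lt (p.2 i x) (p.2 i y)}.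
pose Q (a : A1 + A2) (N : structure L) (v : var J -> N) := match a with
  | inl t => sat (sval t).1 v
  | inr p => sat (sval p).1.1 v <-> sat (sval p).1.1 (v \o reindex (sval p).2) end.
have [pt] := carrier_inhabited M.
have [|||c _ cQ] := realize Msat (D0 := set0) (g0 := fun=> pt) (Q := Q).
- by apply: emb_card_lt small_array; exact: emb_cell.
- move=> [t|p]; first exact: definable_sat.
  apply: definable_iffb; first exact: definable_sat.
  exact: (definable_comp _ (definable_sat _)).
- move=> l.
  have /choice[supp suppP] (a : A1 + A2) := formula_support
    (match a with inl t => (sval t).1 | inr p => (sval p).1.1 end).
  (* U holds the cells seen by the conditions in l together with their images under the reindexings,
     so only its finitely many rows need to be indiscernible. *)
  pose U := flatten [seq supp a ++
    (if a is inr p then map (reindex (sval p).2) (supp a) else [::]) | a <- l].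
  pose X := map (@col I m J) U ++
    flatten [seq (if a is inl t then (sval t).2 else [::]) | a <- l].
  have [e eP] := rank_exists X.
  have [b' bb' b'I] := indisc_rows b (map (@row I m J) U).
  exists (b' \o reindex (fun=> e)) => // a al.
  have suppU z : In z (supp a) -> In z U.
    by move=> za; apply: (In_flatten_map (a := a)) => //; apply/In_cat; left.
  have UX z : In z U -> In (col z) X.
    by move=> zU; apply/In_cat; left; apply/List.in_map_iff; exists z.
  have sP := suppP a; move: al suppU sP; case: a => [[[theta Y] /= [tY tP]]|[[[theta A] h] /= [tA hA]]] al suppU sP.
    apply/(sat_frename (reindex (fun=> e)))/bb' => k ki; apply/sat_frename.
    rewrite -compA reindex_comp; apply: (tP) => i x y xY yY xy; apply/ki/eP => //.
    by apply/In_cat; right; apply: (In_flatten_map al).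
  set a := inr _ in al suppU sP.
  have hU z : In z (supp a) -> In (reindex h z) U.
    move=> za; apply: (In_flatten_map al) => /=; apply/In_cat; right.
    by apply/List.in_map_iff; exists z.
  pose s := [seq z <- supp a | `[< A (row z) (col z) >]].
  have sE z : In z s <-> In z (supp a) /\ A (row z) (col z).
    by split=> [/List.filter_In[za /asboolP]|[za zA]] //; apply/List.filter_In; split=> //; exact/asboolP.
  (* Dependence on A and on the support combine to dependence on their intersection: w changes v
     first outside A, then outside the support. *)
  have tS (v v' : var J -> M) : (forall z, In z s -> v z = v' z) -> sat theta v <-> sat theta v'.
    move=> vv'; pose w (z : var J) := if pselect (A (row z) (col z)) is left _ then v z else v' z.
    rewrite (tA v w); last by move=> z zA; rewrite /w; case: pselect.
    apply: sP => z za; rewrite /w; case: pselect => // zA; apply: vv'; exact/sE.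
  have [C CP] := bounded_on s (fun z => e (col z) + e (h (row z) (col z))).
  (* Neither of the placements e and e after h need dominate the other, so both are compared with g,
     whose gaps are at least C, a bound for all columns they use. *)
  pose g (i : I) x := C * (e x).+1.
  have sI : indisc (fun i => In i (map (@row I m J) s)) b'.
    move=> phi k ki kid; apply: b'I => // i iU; apply: kid => /List.in_map_iff[z [zi zs]].
    by apply: iU; apply/List.in_map_iff; exists z; split=> //; apply: suppU; have /sE[] := zs.
  have es (z z' : var J) : In z s -> lt (col z) (col z') -> e (col z) < e (col z').
    by move=> /sE[/suppU/UX zX _]; exact: eP.
  have gap (z z' : var J) : In z s -> lt (col z) (col z') ->
      C + g (row z) (col z) <= g (row z) (col z').
    by move=> zs /(es _ _ zs); rewrite /g; nia.
  rewrite /= (indisc_compare (g := g) sI tS); first last.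
  - move=> z z' zs z's rr zz'; split; first exact: es.
    by have := gap _ _ zs zz'; have := CP _ z's; lia.
  - by move=> z zs; rewrite /g; have := CP _ zs; nia.
  rewrite -compA reindex_comp (indisc_compare (g := g) sI tS)//.
  - by move=> z zs; rewrite /g /=; have := CP _ zs; nia.
  - move=> z z' zs z's rr zz' /=; split; last first.
      by have := gap _ _ zs zz'; have := CP _ z's; rewrite rr; lia.
    have [zA z'A] := ((sE z).1 zs, (sE z').1 z's).
    apply: eP; first exact: (UX _ (hU _ zA.1)).
    by apply: (hA _ _ _ _ _ zz'); [exact: zA.2|rewrite rr; exact: z'A.2].
exists c; split.
  by move=> theta X tX tP; exact: (cQ (inl (exist _ (theta, X) (conj tX tP)))).
by move=> theta A h tA hA; exact: (cQ (inr (exist _ (theta, A, h) (conj tA hA)))).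
Qed.

End Index.
End Indiscernible.

(** * Dense and witnessed rows *)

(* The integers with two end points, [inr false] at the bottom and [inr true] at the top. *)
Definition extint : Type := (int + bool)%type.
Notation Fin z := (inl z : extint).
Notation Bot := (inr false : extint).
Notation Top := (inr true : extint).

Definition ext_lt (x y : extint) : bool := match x, y with
  | inl a, inl b => (a < b)%R
  | inl _, inr b => b
  | inr a, inl _ => ~~ a
  | inr a, inr b => ~~ a && b end.

Definition ext_le (x y : extint) : bool := (x == y) || ext_lt x y.

Lemma ext_lt_irr : irreflexive ext_lt.
Proof. by move=> [a|[]] //=; lia. Qed.

Lemma ext_lt_trans : transitive ext_lt.
Proof. by move=> [a|[]] [b|[]] [c|[]] //=; lia. Qed.

Lemma ext_lt_total x y : [|| ext_lt x y, x == y | ext_lt y x].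
Proof. case: x y => [a|[]] [b|[]] //=. rewrite (inj_eq (@inl_inj _ _)); lia. Qed.

Lemma ext_le_Fin a b : ext_le (Fin a) (Fin b) = (a <= b)%R.
Proof. rewrite /ext_le (inj_eq (@inl_inj _ _)) /=; lia. Qed.

Lemma emb_extint : emb extint nat.
Proof. by exists pickle; exact: pcan_inj pickleK. Qed.

Definition clip (N : nat) (x : extint) : extint := match x with
  | inl a => Fin a | inr false => Fin (- Posz N)%R | inr true => Fin (Posz N) end.

Definition upd I J (f : I -> J) (w : I) (x : J) (i : I) : J :=
  if pselect (i = w) then x else f i.

Lemma upd_same I J (f : I -> J) w x : upd f w x w = x.
Proof. by rewrite /upd; case: pselect. Qed.

Lemma upd_other I J (f : I -> J) w x i : i <> w -> upd f w x i = f i.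
Proof. by rewrite /upd; case: pselect. Qed.

(** A form of Tukey's lemma: [Q F] sees only the trace of X on F, and there the union of a chain
    agrees with a member of it, or with the empty set. *)
Lemma finite_character_max I (Q : seq I -> set I -> Prop) :
  (forall F X Y, (forall i, In i F -> (X i <-> Y i)) -> Q F X -> Q F Y) ->
  (forall F, Q F set0) ->
  exists X : set I, (forall F, Q F X) /\
    forall i, ~ X i -> exists F, ~ Q F (X `|` [set i]).
Proof.
move=> Qloc Q0.
have [X [PX maxX]] : exists X, (forall F, Q F X) /\
    forall Y, X `<` Y -> ~ forall F, Q F Y.
  apply: (@Zorn_bigcup _ (fun X => forall F, Q F X)) => C CP Ctot F.
  have [X CX FX] : exists2 X, C X \/ X = set0 &
      forall i, In i F -> (\bigcup_(Y in C) Y) i -> X i.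
    elim: F => [|i F [X CX FX]]; first by exists set0; [right|].
    have [[Y CY Yi]|nU] := pselect ((\bigcup_(Y in C) Y) i); last first.
      by exists X => // j [<-|]; [|exact: FX].
    have [CX'|X0] := CX; last first.
      exists Y; first by left.
      by move=> j [<-//|jF /(FX _ jF)]; rewrite X0.
    have [XY|YX] := Ctot _ _ CX' CY.
      exists Y; first by left.
      by move=> j [<-//|jF /(FX _ jF)/XY].
    exists X => // j [<- _|]; [exact: YX|exact: FX].
  have [CX'|X0] := CX; last first.
    apply: Qloc (Q0 F) => i iF; split=> // /(FX _ iF); by rewrite X0.
  apply: Qloc (CP _ CX' F) => i iF; split; last exact: FX.
  by move=> Xi; exists X.
exists X; split=> // i nXi; apply/existsNP/maxX.
split=> [j Xj|sub]; first by left.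
by apply/nXi/sub; right.
Qed.

Section Density.
Variables (I : Type) (D : seq I -> (I -> extint) -> (I -> extint) -> Prop).
Hypothesis D_mono : forall F F' lo lo' hi hi', D F lo hi ->
  (forall i, In i F' -> [/\ In i F, ext_le (lo' i) (lo i) & ext_le (hi i) (hi' i)]) ->
  D F' lo' hi'.
Hypothesis D_base : forall F, D F (fun=> Fin 0%R) (fun=> Fin 1%R).

(* An end point Bot or Top is met only up to some integer: this leaves columns strictly
   between the points found by D and the parameters at the ends, which is what makes room
   for moving one row without disturbing the boxes used for the others. *)
Definition Dlim F lo hi : Prop := exists N, D F (clip N \o lo) (clip N \o hi).

(** The bound grows by C, above all finite ends of the old box, since a [Bot] replacing such an end
    must be clipped below it. Growing the bound enlarges a box only if no lower end is [Top] and no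
    upper end is [Bot]. *)
Lemma Dlim_mono F lo lo' hi hi' : Dlim F lo hi ->
  (forall i, In i F -> [/\ lo i <> Top, hi i <> Bot,
     ext_le (lo' i) (lo i) & ext_le (hi i) (hi' i)]) ->
  Dlim F lo' hi'.
Proof.
move=> [N DN] le.
pose size_ext (x : extint) := if x is inl a then `|a|%N else 0.
have [C CP] := bounded_on F (fun i => size_ext (lo i) + size_ext (hi i)).
exists (N + C); apply: D_mono DN _ => i iF; split=> //=.
  have := CP i iF; have [] := le i iF.
  case: (lo i) => [a|[]]; case: (lo' i) => [b|[]] //=; rewrite !ext_le_Fin //=; lia.
have := CP i iF; have [] := le i iF.
by case: (hi i) => [a|[]]; case: (hi' i) => [b|[]] //=; rewrite !ext_le_Fin //=; lia.
Qed.

Lemma ext_lexx x : ext_le x x.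
Proof. by rewrite /ext_le eqxx. Qed.

Lemma Dlim_local F lo lo' hi hi' : Dlim F lo hi ->
  (forall i, In i F -> lo i = lo' i /\ hi i = hi' i) -> Dlim F lo' hi'.
Proof.
move=> [N DN] e; exists N; apply: D_mono DN _ => i iF.
by have [e1 e2] := e i iF; rewrite /= e1 e2; split=> //; exact: ext_lexx.
Qed.

Definition bounded_itv (x y : extint) : Prop :=
  exists a b : int, [/\ x = Fin a, y = Fin b & (a < b)%R].

(** Boxes vary only in the rows of S; elsewhere the prescribed ends keep the box chosen for one row
    independent of the moving columns of the others. *)
Definition box (S : set I) (L lo hi : I -> extint) : Prop := forall i,
  (S i -> bounded_itv (lo i) (hi i)) /\ (~ S i -> lo i = L i /\ hi i = Top).

Lemma box_extend S S' L L' F lo hi : box S L lo hi ->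
  (forall i, In i F -> (S i <-> S' i) /\ (~ S i -> L i = L' i)) ->
  exists lo' hi', box S' L' lo' hi' /\ forall i, In i F -> lo i = lo' i /\ hi i = hi' i.
Proof.
move=> b e.
exists (fun i => if pselect (In i F) is left _ then lo i else
  if pselect (S' i) is left _ then Fin 0%R else L' i).
exists (fun i => if pselect (In i F) is left _ then hi i else
  if pselect (S' i) is left _ then Fin 1%R else Top).
split=> i; last by case: pselect.
case: pselect => iF.
  have [SS' LL'] := e i iF; have [b1 b2] := b i; split=> [/SS'/b1//|nS'].
  have nS : ~ S i by move/SS'.
  by rewrite -LL'//; exact: b2.
by case: pselect => S'i; split=> // _; exists 0%R, 1%R.
Qed.

(* S is maximal such that all bounded boxes on S are met, which yields for every w outside S
   an interval (l_w, r_w) that is missed for some box on S.  Then L is fixed by a maximal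
   set E of rows that can be cut down to (l_w, Top) keeping S dense: for w in E the failure
   occurs at r_w, for w outside E already at l_w. *)
Lemma density_dichotomy : exists (S : set I) (L : I -> extint),
  [/\ forall i, L i <> Top,
      forall F lo hi, box S L lo hi -> Dlim F lo hi &
      forall w, ~ S w -> exists F lo hi, box S L lo hi /\
        ((exists l r, [/\ L w = Fin l, (l < r)%R & ~ Dlim F lo (upd hi w (Fin r))]) \/
         (exists l, L w = Bot /\ ~ Dlim F (upd lo w (Fin l)) hi))].
Proof.
pose bot : I -> extint := fun=> Bot.
have [||S [SP Smax]] := @finite_character_max I
    (fun F X => forall lo hi, box X bot lo hi -> Dlim F lo hi).
- move=> F X Y XY QX lo hi bY.
  have [|lo' [hi' [bX e]]] := box_extend (S' := X) (L' := bot) (F := F) bY.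
    by move=> i iF; split=> //; rewrite XY.
  by apply: Dlim_local (QX _ _ bX) _ => i /e[-> ->].
(* For X empty every side is ([Bot], [Top]), and clipped at 1 it contains the side from 0 to 1. *)
- move=> F lo hi b; exists 1; apply: D_mono (D_base F) _ => i iF.
  by have [_ [//|e1 e2]] := b i; rewrite /= e1 e2.
have /choice[W WP] : forall w, exists W : seq I * (I -> extint) * (I -> extint),
    ~ S w -> box (S `|` [set w]) bot W.1.2 W.2 /\ ~ Dlim W.1.1 W.1.2 W.2.
  move=> w; have [Sw|/Smax[F]] := pselect (S w).
    by exists ([::], bot, bot).
  by move=> /existsNP[lo /existsNP[hi /not_implyP[b nD]]]; exists (F, lo, hi).
pose LE (E : set I) i := if pselect (E i) is left _ then (W i).1.2 i else Bot.
have [||E [EP Emax]] := @finite_character_max I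
    (fun F X => forall lo hi, box S (LE X) lo hi -> Dlim F lo hi).
- move=> F X Y XY QX lo hi bY.
  have [|lo' [hi' [bX e]]] := box_extend (S' := S) (L' := LE X) (F := F) bY.
    move=> i iF; split=> // _; rewrite /LE.
    by case: pselect => Yi; case: pselect => // Xi; exfalso; [apply: Xi|apply: Yi]; apply/XY.
  by apply: Dlim_local (QX _ _ bX) _ => i /e[-> ->].
- move=> F lo hi b; apply: SP => i; have [b1 b2] := b i; split=> //.
  by move/b2; rewrite /LE; case: pselect.
(* W says nothing about rows in S; the value [Bot] there keeps L away from [Top]. *)
pose L i := if pselect (S i) is left _ then Bot else LE E i.
have boxL lo hi : box S L lo hi <-> box S (LE E) lo hi.
  by split=> b i; have [b1 b2] := b i; split=> // nS; have := b2 nS;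
    rewrite /L; case: pselect.
exists S, L; split.
- move=> i; rewrite /L; case: pselect => // nS; rewrite /LE; case: pselect => // Ei.
  have [/(_ i)[]] := WP i nS; move=> /(_ (or_intror erefl))[a [b [-> _ _]]] _ //.
- by move=> F lo hi /boxL; exact: EP.
move=> w nSw.
have Lw : L w = LE E w by rewrite /L; case: pselect.
have [bw nDw] := WP w nSw.
have [l [r [el er lr]]] := (bw w).1 (or_intror erefl).
have [Ew|nEw] := pselect (E w).
  have {}Lw : L w = Fin l by rewrite Lw /LE; case: pselect => // _; rewrite el.
  exists (W w).1.1, (fun i => if pselect (S i) is left _ then (W w).1.2 i else L i).
  exists (fun i => if pselect (S i) is left _ then (W w).2 i else Top).
  split.
    move=> i; case: pselect => Si; split=> // _.
    by have [/(_ (or_introl Si))] := bw i.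
  (* The missed box [W w] has sides ([Bot], [Top]) in the other rows outside S; raising [Bot] to
     [L i] shrinks it, so it is still missed. *)
  left; exists l, r; split=> // Dw; apply: nDw; apply: Dlim_mono Dw _ => i iF.
  have [->|iw] := pselect (i = w).
    by rewrite upd_same; case: pselect => // _; rewrite Lw el er !ext_lexx.
  rewrite upd_other//; case: pselect => Si.
    have [/(_ (or_introl Si))] := bw i; move=> [a [b [-> -> _]]] _.
    by rewrite !ext_lexx.
  have [_ [|-> ->]] := bw i; first by case.
  split=> //.
    rewrite /L; case: pselect => // _; rewrite /LE; case: pselect => // Ei.
    by have [/(_ i)[/(_ (or_intror erefl))[a [b [-> _ _]]]]] := WP i Si.
  by rewrite /L; case: pselect => // _; rewrite /LE; case: pselect => // Ei;
    have [/(_ i)[/(_ (or_intror erefl))[a [b [-> _ _]]]]] := WP i Si.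
have [F] := Emax w nEw.
move=> /existsNP[lo /existsNP[hi /not_implyP[b nD]]].
(* The box refuting the addition of w to E has lower end l in row w. With [Bot] restored it is a box
   for L, and l is the end at which it fails. *)
exists F, (upd lo w Bot), hi; split.
  apply/boxL => i; have [b1 b2] := b i; have [iw|iw] := pselect (i = w).
    rewrite iw upd_same; split=> // _; rewrite /LE; case: pselect => // _.
    by split=> //; have [_ /(_ nSw)[]] := b w.
  rewrite upd_other//; split=> // /b2[-> ->]; split=> //; rewrite /LE.
  case: pselect => [[Ei|//]|nEi]; case: pselect => // Ei'.
  by case: nEi; left.
right; exists l; split; first by rewrite Lw /LE; case: pselect.
move=> D'; apply: nD; apply: Dlim_local D' _ => i iF; split=> //.
have [->|iw] := pselect (i = w); last by rewrite !upd_other.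
rewrite upd_same; have [_ /(_ nSw)[-> _]] := b w.
by rewrite /LE; case: pselect => // -[]; right.
Qed.

End Density.

(** * Patterns and cuts *)

Section Pattern.
Variables (L : language) (K : Type) (M : structure L).
Hypothesis Msat : saturated K M.

(** Patterns require finite parameter tuples; the second component picks out the finitely many
    parameters that [chi] mentions. *)
Lemma finite_parameters X Y (chi : formula L (X + Y)) :
  exists p : {m : nat & (formula L (X + 'I_m) * ((Y -> M) -> 'I_m -> M))%type},
    forall (a : X -> M) e,
      sat (projT2 p).1 (assign a ((projT2 p).2 e)) <-> sat chi (assign a e).
Proof.
have [s sP] := formula_support chi.
pose sY := pmap (fun z : X + Y => if z is inr y then Some y else None) s.
have sYP y : In (inr y) s -> In y sY.
  rewrite /sY; elim: (s) => //= -[x|z] t IHt [//|].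
  - by move/IHt.
  - by move=> [->]; left.
  - by move/IHt; right.
have [idx idxP] := index_list sY; have [pt] := carrier_inhabited M.
have [rho rhoP] := choice (idxP M pt).
pose r (z : X + Y) : X + 'I_(size sY).+1 :=
  match z with inl x => inl x | inr y => inr (idx y) end.
exists (existT (fun m => (formula L (X + 'I_m) * ((Y -> M) -> 'I_m -> M))%type) _
  (frename r chi, rho)) => a e /=.
have E : sat chi (assign a (rho e) \o r) <-> sat chi (assign a e).
  by apply: sP => -[x|y] //= /sYP; exact: rhoP.
by have := sat_frename r chi (assign a (rho e)); tauto.
Qed.

Lemma emb_add_cell (X : countType) I (m : I -> nat) J (i0 : I) :
  emb J nat -> emb (X + cell m J) (I * nat).
Proof.
move=> [f fI].
have [pk pkI] : emb (X + nat * nat) nat by exists pickle; exact: pcan_inj pickleK.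
exists (fun z => match z with
  inl x => (i0, pk (inl x)) | inr z => (row z, pk (inr (f (col z), val (projT2 z).2))) end).
move=> [x|[i [j k]]] [x'|[i' [j' k']]] [] /=.
- by move=> /pkI[->].
- by move=> _ /pkI.
- by move=> _ /pkI.
move=> e; case: i' / e k' => k' /pkI[].
by rewrite /col /= => /fI-> /val_inj->.
Qed.

(** By monotonicity the position of the cut decides all columns of a row, so saturation realises
    each path in M itself. Strictness of the inclusion at j comes from a tuple with its cut at j +
    1. *)
Lemma srd_intro n (I : Type) (Y : I -> Type)
    (chi : forall t, formula L ('I_n + Y t)) (c : forall t, nat -> Y t -> M) :
  card_lt (I * nat) K ->
  (forall t j a, sat (chi t) (assign a (c t j)) -> sat (chi t) (assign a (c t j.+1))) ->
  (forall (eta : I -> nat) (F : seq I), exists a : 'I_n -> M, forall t, In t F ->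
     sat (chi t) (assign a (c t (eta t))) /\
     forall j, j < eta t -> ~ sat (chi t) (assign a (c t j))) ->
  exists (m : I -> nat) (psi : forall t, formula L ('I_n + 'I_(m t)))
    (d : forall t, nat -> 'I_(m t) -> M), srd_pattern psi d.
Proof.
move=> small mono fin.
pose p t := cid (finite_parameters (chi t)).
pose m t := projT1 (sval (p t)).
pose psi t : formula L ('I_n + 'I_(m t)) := (projT2 (sval (p t))).1.
pose d t j : 'I_(m t) -> M := (projT2 (sval (p t))).2 (c t j).
have psiE t j a : sat (psi t) (assign a (d t j)) <-> sat (chi t) (assign a (c t j)).
  exact: (svalP (p t)).
have {}mono t j k a : j <= k ->
    sat (psi t) (assign a (d t j)) -> sat (psi t) (assign a (d t k)).
  move=> /subnKC<-; elim: (k - j) => [|l IH]; first by rewrite addn0.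
  by rewrite addnS => /IH/psiE/mono/psiE.
exists m, psi, d; split; last first.
  move=> t j; split=> [a|sub]; first exact: mono.
  have [a /(_ t (or_introl erefl))[at1 /(_ j (ltnSn j))nat0]] := fin (fun=> j.+1) [:: t].
  by apply/nat0/psiE/sub/psiE.
move=> eta; exists M, id; split; first by [].
have [pt] := carrier_inhabited M.
have [[t0 _]|noI] := pselect (exists t : I, True); last first.
  by exists (fun=> pt) => phi [t]; case: noI; exists t.
pose r t (j : nat) (z : 'I_n + 'I_(m t)) : 'I_n + cell m nat :=
  match z with inl x => inl x | inr k => inr (existT _ t (j, k)) end.
have [|||v v0 vQ] := realize Msat (D0 := range inr)
    (g0 := fun z : 'I_n + cell m nat => match z with inl _ => pt
      | inr z => d (row z) (col z) (projT2 z).2 end)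
    (Q := fun (a : I * nat) N v => eta a.1 <= a.2 <-> sat (psi a.1) (v \o r a.1 a.2)).
- by apply: emb_card_lt small; apply: emb_add_cell => //; exists id.
- move=> [t j]; apply: definable_iffb; first exact: definable_const.
  exact: (definable_comp _ (definable_sat _)).
- move=> l; have [a aP] := fin eta (map fst l).
  exists (fun z => match z with inl x => a x
      | inr z => d (row z) (col z) (projT2 z).2 end).
    by move=> _ [z _ <-].
  move=> [t j] tjl /=; have [|t1 t2] := aP t.
    by apply/List.in_map_iff; exists (t, j).
  have -> : (fun z => match z with inl x => a x
      | inr z => d (row z) (col z) (projT2 z).2 end) \o r t j = assign a (d t j).
    by apply: funext => -[].
  split=> [ej|/psiE tj]; first by apply: mono ej _; exact/psiE.
  by rewrite leqNgt; apply/negP => /t2.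
exists (v \o inl) => _ [t [j ->]].
have E : sat (instance (psi t) (d t j)) (assign (v \o inl) id) <->
    sat (psi t) (v \o r t j).
  have <- : assign (v \o inl) id \o (fun z : 'I_n + 'I_(m t) => match z with
      inl x => inl x | inr k => inr (d t j k) end) = v \o r t j.
    by apply: funext => -[x|k] //=; rewrite v0//; exists (existT _ t (j, k)).
  exact: sat_frename.
have /= := vQ (t, j); rewrite -E /formula_if.
by case: leqP => _ [h1 h2] /=; [exact: h1|move/h2].
Qed.

End Pattern.

Section Cuts.
Variables (L : language) (I : Type) (m : I -> nat) (n0 n1 : nat).
Variable phi : forall i, formula L (('I_n0 + 'I_n1) + 'I_(m i)).

Definition entry J N (b : cell m J -> N) i (x : J) : 'I_(m i) -> N :=
  fun k => b (existT _ i (x, k)).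
Arguments entry {J N} b i x.

(** Along an increasing row [phi i] turns from false to true once; this locates the turning point
    between [lo i] and [hi i]. *)
Definition in_cuts J (N : structure L) (b : cell m J -> N) (F : seq I)
    (lo hi : I -> J) (a0 : 'I_n0 -> N) (a1 : 'I_n1 -> N) : Prop :=
  forall i, In i F ->
    ~ sat (phi i) (assign (assign a0 a1) (entry b i (lo i))) /\
    sat (phi i) (assign (assign a0 a1) (entry b i (hi i))).

Lemma in_cuts_ext J J' (N : structure L) (b : cell m J -> N) (b' : cell m J' -> N)
    F lo hi lo' hi' a0 a1 :
  (forall i, In i F -> entry b i (lo i) = entry b' i (lo' i) /\
     entry b i (hi i) = entry b' i (hi' i)) ->
  in_cuts b F lo hi a0 a1 -> in_cuts b' F lo' hi' a0 a1.
Proof. by move=> e H i iF; have [<- <-] := e i iF; exact: H. Qed.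

(** Passed to [definable_ex], it quantifies the left variables and keeps the right ones. *)
Definition some_inr A B (z : A + B) : option B := if z is inr b then Some b else None.

Lemma definable_in_cuts J F (lo hi : I -> J) :
  definable (fun (N : structure L) (v : 'I_n1 + ('I_n0 + cell m J) -> N) =>
    in_cuts (v \o inr \o inr) F lo hi (v \o inr \o inl) (v \o inl)).
Proof.
apply: definable_all => i.
pose r x (z : ('I_n0 + 'I_n1) + 'I_(m i)) : 'I_n1 + ('I_n0 + cell m J) := match z with
  inl (inl k) => inr (inl k) | inl (inr k) => inl k
| inr k => inr (inr (existT _ i (x, k))) end.
have rE x N (v : 'I_n1 + ('I_n0 + cell m J) -> N) : v \o r x =
    assign (assign (v \o inr \o inl) (v \o inl)) (entry (v \o inr \o inr) i x).
  by apply/funext => -[[k|k]|k].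
apply: definable_iff (definable_and
  (definable_not (definable_comp (r (lo i)) (definable_sat (phi i))))
  (definable_comp (r (hi i)) (definable_sat (phi i)))) => N v.
by rewrite !rE.
Qed.

Lemma definable_cuts J F (lo hi : I -> J) :
  definable (fun (N : structure L) (v : 'I_n0 + cell m J -> N) =>
    exists a1, in_cuts (v \o inr) F lo hi (v \o inl) a1).
Proof.
apply: definable_iff (definable_ex (@some_inr _ _) (definable_in_cuts F lo hi)) => N v.
split=> [[u uv H]|[a1 H]].
  have e : u \o inr = v by apply/funext => z; exact: uv.
  by exists (u \o inl); move: H; rewrite e.
by exists (assign a1 v) => // -[//|z] _ [<-].
Qed.

Lemma definable_ex_cuts J F (lo hi : I -> J) :
  definable (fun (N : structure L) (v : cell m J -> N) =>
    exists a0 a1, in_cuts v F lo hi a0 a1).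
Proof.
apply: definable_iff (definable_ex (@some_inr _ _) (definable_cuts F lo hi)) => N v.
split=> [[u uv [a1 H]]|[a0 [a1 H]]].
  have e : u \o inr = v by apply/funext => z; exact: uv.
  by exists (u \o inl), a1; move: H; rewrite e.
by exists (assign a0 v); [move=> -[//|z] _ [<-]|exists a1].
Qed.

End Cuts.

Arguments entry {I m J N} b i x.

(** * Extracting the two patterns *)

Section Main.
Variables (L : language) (K : Type) (M : structure L).
Hypothesis Msat : saturated K M.
Variables (I : Type) (m : I -> nat) (n0 n1 : nat).
Hypothesis small_array : card_lt (I * nat) K.
Variable phi : forall i, formula L (('I_n0 + 'I_n1) + 'I_(m i)).

Lemma assign_eta X P N (a : X + P -> N) : assign (a \o inl) (a \o inr) = a.
Proof. by apply: funext => -[]. Qed.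

(** Consistency gives a tuple in an elementary extension; for finitely many rows its existence is a
    first-order property of the array and descends to M. *)
Lemma srd_pattern_cuts (b : forall i, nat -> 'I_(m i) -> M) :
  srd_pattern (X := ('I_n0 + 'I_n1)%type) phi b ->
  let v : cell m nat -> M := fun z => b (row z) (col z) (projT2 z).2 in
  (forall i j k a, j < k -> sat (phi i) (assign a (entry v i j)) ->
     sat (phi i) (assign a (entry v i k))) /\
  (forall F (j : I -> nat), exists a0 a1, in_cuts phi v F j (fun i => (j i).+1) a0 a1).
Proof.
move=> [cons incl] v; split.
  move=> i j k a; elim: k => // k IHk; rewrite ltnS leq_eqVlt => /orP[/eqP->|/IHk h /h].
    exact: (incl i k).1.
  exact: (incl i k).1.
move=> F j; have [theta tP] := definable_ex_cuts phi F j (fun i => (j i).+1).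
have [N [f [ef [a aP]]]] := cons (fun i => (j i).+1).
apply/tP/(elementary_embedding_sat ef)/tP.
exists (a \o inl), (a \o inr); rewrite /in_cuts assign_eta => i iF.
have inst k : sat (formula_if ((j i).+1 <= k)%N (instance (phi i) (b i k))) (assign a f).
  by apply: aP; exists i, k.
have E k : sat (instance (phi i) (b i k)) (assign a f) <->
    sat (phi i) (assign a (entry (f \o v) i k)).
  have <- : assign a f \o (fun z : ('I_n0 + 'I_n1) + 'I_(m i) => match z with
      inl x => inl x | inr y => inr (b i k y) end) = assign a (entry (f \o v) i k).
    by apply: funext => -[x|y].
  exact: sat_frename.
have := inst (j i); have := inst (j i).+1; rewrite /formula_if ltnn leqnn /= => h1 h0.
by split; [move/E/h0|apply/E].
Qed.

Notation ext_cell := (cell m extint).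

Definition increasing_array (c : ext_cell -> M) : Prop :=
  forall i x y a, ext_le x y -> sat (phi i) (assign a (entry c i x)) ->
    sat (phi i) (assign a (entry c i y)).

Definition indiscernible_array (c : ext_cell -> M) : Prop :=
  forall (theta : formula L ext_cell) (A : I -> extint -> Prop) h,
    depends_on M A theta ->
    (forall i x y, A i x -> A i y -> ext_lt x y -> ext_lt (h i x) (h i y)) ->
    (sat theta c <-> sat theta (c \o reindex h)).

Lemma in_cuts_depends J (N : structure L) (v v' : cell m J -> N) F lo hi a0 a1
    (A : I -> J -> Prop) :
  (forall i, In i F -> A i (lo i) /\ A i (hi i)) ->
  (forall z, A (row z) (col z) -> v z = v' z) ->
  in_cuts phi v F lo hi a0 a1 -> in_cuts phi v' F lo hi a0 a1.
Proof.
move=> FA e; apply: in_cuts_ext => i /FA[Al Ah].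
by split; apply: funext => k; apply: e.
Qed.

Lemma indiscernible_array_exists (b : forall i, nat -> 'I_(m i) -> M) :
  srd_pattern (X := ('I_n0 + 'I_n1)%type) phi b ->
  exists c : ext_cell -> M, [/\ increasing_array c, indiscernible_array c &
    forall F, exists a0 a1, in_cuts phi c F (fun=> Fin 0%R) (fun=> Fin 1%R) a0 a1].
Proof.
move=> /srd_pattern_cuts; set v := (fun z => _) => -[vinc vcut].
have [c [c_based c_ind]] := mutually_indiscernible Msat small_array emb_extint
  ext_lt_irr ext_lt_trans ext_lt_total v.
exists c; split=> //.
- move=> i x y a /orP[/eqP->//|xy] h; apply: contrapT => nh.
  (* Monotonicity is stated as the absence of a tuple whose cut runs backwards, from y down to x. *)
  have [theta tP] := definable_not (definable_ex_cuts phi [:: i] (fun=> y) (fun=> x)).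
  suff /tP : sat theta c.
    by apply; exists (a \o inl), (a \o inr) => _ [<-|//]; rewrite assign_eta.
  apply: (c_based theta [:: x; y]).
  + move=> w w' e; split=> /tP H; apply/tP => -[a0 [a1 h']]; apply: H; exists a0, a1;
    move: h'; apply: (in_cuts_depends (A := fun _ z => In z [:: x; y])) => //.
    * by move=> _ _; split; [right; left|left].
    * by move=> z /e.
    * by move=> _ _; split; [right; left|left].
  + move=> f fi; apply/tP => -[a0 [a1 /(_ i (or_introl erefl))[n2 h2]]]; apply: n2.
    apply: (vinc i (f i x) (f i y)) h2; apply: fi => //; first by left.
    by right; left.
- move=> F; have [theta tP] := definable_ex_cuts phi F (fun=> Fin 0%R) (fun=> Fin 1%R).
  apply/tP; apply: (c_based theta [:: Fin 0%R; Fin 1%R]).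
    move=> w w' e; split=> /tP[a0 [a1 h']]; apply/tP; exists a0, a1; move: h';
    apply: (in_cuts_depends (A := fun _ z => In z [:: Fin 0%R; Fin 1%R])) => //.
    * by move=> _ _; split; [left|right; left].
    * by move=> _ _; split; [left|right; left].
    * by move=> z /e.
  move=> f fi; apply/tP; have [a0 [a1 H]] := vcut F (fun i => f i (Fin 0%R)).
  exists a0, a1 => i /H[h0 h1]; split=> //.
  have : f i (Fin 0%R) < f i (Fin 1%R) by apply: fi => //; [left|right; left].
  rewrite leq_eqVlt => /orP[/eqP e|/vinc]; last by move=> /(_ i _ h1).
  by move: h1; rewrite e.
Qed.

Section Rows.
Variable c : ext_cell -> M.
Hypotheses (c_inc : increasing_array c) (c_ind : indiscernible_array c).

Lemma in_cuts_mono a0 a1 F F' lo lo' hi hi' :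
  (forall i, In i F' -> [/\ In i F, ext_le (lo' i) (lo i) & ext_le (hi i) (hi' i)]) ->
  in_cuts phi c F lo hi a0 a1 -> in_cuts phi c F' lo' hi' a0 a1.
Proof.
move=> le H i /le[/H[h1 h2] lo_le hi_le]; split; last exact: c_inc h2.
by move/(c_inc lo_le).
Qed.

Lemma central_realization :
  (forall F, exists a0 a1, in_cuts phi c F (fun=> Fin 0%R) (fun=> Fin 1%R) a0 a1) ->
  exists a0 a1, forall F, in_cuts phi c F (fun=> Fin 0%R) (fun=> Fin 1%R) a0 a1.
Proof.
move=> fin; have [[i0 _]|noI] := pselect (exists i : I, True); last first.
  by have [a0 [a1 _]] := fin [::]; exists a0, a1 => F i; case: noI; exists i.
have [pt] := carrier_inhabited M.
pose c' (a : 'I_n1 + ('I_n0 + ext_cell) -> M) := a \o inr \o inr.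
have [||| v v0 vQ] := realize Msat (D0 := range (inr \o inr))
    (g0 := fun z : 'I_n1 + ('I_n0 + ext_cell) => if z is inr (inr z) then c z else pt)
    (Q := fun F N v => in_cuts phi (v \o inr \o inr) F (fun=> Fin 0%R) (fun=> Fin 1%R)
       (v \o inr \o inl) (v \o inl)).
- apply: emb_card_lt small_array.
  apply: emb_trans (@emb_add_cell ('I_n1 + 'I_n0)%type _ _ _ i0 emb_extint).
  exists (fun z => match z with inl x => inl (inl x) | inr (inl x) => inl (inr x)
    | inr (inr z) => inr z end).
  by move=> [x|[x|x]] [y|[y|y]] // [->].
- by move=> F; exact: definable_in_cuts.
- move=> l; have [a0 [a1 H]] := fin (flatten l).
  exists (assign a1 (assign a0 c)); first by move=> _ [z _ <-].
  move=> F Fl i iF; apply: H.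
  by elim: l Fl => //= G l IH [e|/IH Fi]; apply/In_cat; [left; rewrite e|right].
exists (v \o inr \o inl), (v \o inl) => F.
have <- : v \o inr \o inr = c; last exact: vQ.
by apply: funext => z; rewrite /= v0//; exists z.
Qed.

Definition meets a0 F lo hi : Prop := exists a1, in_cuts phi c F lo hi a0 a1.

Lemma meets_mono a0 F F' lo lo' hi hi' : meets a0 F lo hi ->
  (forall i, In i F' -> [/\ In i F, ext_le (lo' i) (lo i) & ext_le (hi i) (hi' i)]) ->
  meets a0 F' lo' hi'.
Proof. by move=> [a1 H] le; exists a1; exact: in_cuts_mono H. Qed.

Lemma extend_along T (e : T -> I) (eta : T -> nat) : injective e ->
  exists eta' : I -> nat, forall t, eta' (e t) = eta t.
Proof.
move=> eI; have /choice[f fP] : forall i, exists n, forall t, e t = i -> eta t = n.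
  move=> i; have [[t ti]|nt] := pselect (exists t, e t = i).
    by exists (eta t) => u; rewrite -ti => /eI->.
  by exists 0 => t ti; case: nt; exists t.
by exists f => t; rewrite -(fP (e t) t).
Qed.

Lemma small_rows T (e : T -> I) : injective e -> card_lt (T * nat) K.
Proof.
move=> eI; apply: emb_card_lt small_array; exists (fun p => (e p.1, p.2)).
by move=> [t j] [u k] [/eI-> ->].
Qed.

(** Row t uses [phi] with [a0] moved into the parameters, at the columns 0, 1, 2 and so on. *)
Lemma fibre_pattern T (e : T -> I) a0 (S : set I) (B : I -> extint) :
  injective e -> (forall t, S (e t)) ->
  (forall F lo hi, box S B lo hi -> Dlim (meets a0) F lo hi) ->
  exists (m' : T -> nat) (psi : forall t, formula L ('I_n1 + 'I_(m' t)))
    (d : forall t, nat -> 'I_(m' t) -> M), srd_pattern psi d.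
Proof.
move=> eI eS dense.
pose r i (z : ('I_n0 + 'I_n1) + 'I_(m i)) : 'I_n1 + ('I_n0 + 'I_(m i)) := match z with
  inl (inl k) => inr (inl k) | inl (inr k) => inl k | inr k => inr (inr k) end.
have rE i j a1 : sat (frename (r i) (phi i))
      (assign a1 (assign a0 (entry c i (Fin (Posz j))))) <->
    sat (phi i) (assign (assign a0 a1) (entry c i (Fin (Posz j)))).
  have <- : assign a1 (assign a0 (entry c i (Fin (Posz j)))) \o r i =
      assign (assign a0 a1) (entry c i (Fin (Posz j))).
    by apply: funext => -[[k|k]|k].
  exact: sat_frename.
apply: (srd_intro Msat (chi := fun t => frename (r (e t)) (phi (e t)))
  (c := fun t j => assign a0 (entry c (e t) (Fin (Posz j))))).
- exact: small_rows eI.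
- move=> t j a1 /rE h; apply/rE; apply: c_inc h; rewrite ext_le_Fin; lia.
move=> eta F; have [eta' eta'P] := extend_along eta eI.
have [|N [a1 aP]] := dense (map e F)
    (* Consecutive ends pin the cut down; for the value 0 the lower end is the column -1, which
       exists in the array though not in the pattern. *)
    (fun i => if pselect (S i) is left _ then Fin (Posz (eta' i) - 1)%R else B i)
    (fun i => if pselect (S i) is left _ then Fin (Posz (eta' i)) else Top).
  move=> i; case: pselect => Si; split=> // _.
  by do 2!eexists; split; [reflexivity|reflexivity|lia].
exists a1 => t tF; have [|] := aP (e t).
  by apply/List.in_map_iff; exists t.
rewrite /=; case: pselect => // _ /=; rewrite eta'P => h0 h1.
split=> [|j jt]; first exact/rE.
by move/rE => hj; apply: h0; apply: c_inc hj; rewrite ext_le_Fin; lia.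
Qed.

(** The formula of row w says that the fibre meets its witnessing box with one end moved to a
    j-dependent column. The columns are relabelled so that over [a0] every selected box is met at
    [eta] and missed one step before. *)
Lemma projection_pattern T (e : T -> I) a0 (S : set I) (B : I -> extint) :
  injective e -> (forall t, ~ S (e t)) ->
  (forall F lo hi, box S B lo hi -> Dlim (meets a0) F lo hi) ->
  (forall w, ~ S w -> exists F lo hi, box S B lo hi /\
    ((exists l r, [/\ B w = Fin l, (l < r)%R & ~ Dlim (meets a0) F lo (upd hi w (Fin r))]) \/
     (exists l, B w = Bot /\ ~ Dlim (meets a0) F (upd lo w (Fin l)) hi))) ->
  exists (m' : T -> nat) (psi : forall t, formula L ('I_n0 + 'I_(m' t)))
    (d : forall t, nat -> 'I_(m' t) -> M), srd_pattern psi d.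
Proof.
move=> eI neS dense wit.
have /choice[Fl] : forall w, exists Fl : seq I * (I -> extint) * (I -> extint), ~ S w ->
    box S B Fl.1.2 Fl.2 /\
    ((exists l r, [/\ B w = Fin l, (l < r)%R &
       ~ Dlim (meets a0) Fl.1.1 Fl.1.2 (upd Fl.2 w (Fin r))]) \/
     (exists l, B w = Bot /\ ~ Dlim (meets a0) Fl.1.1 (upd Fl.1.2 w (Fin l)) Fl.2)).
  move=> w; have [Sw|nSw] := pselect (S w); first by exists ([::], B, B).
  by have [F [lo [hi H]]] := wit w nSw; exists (F, lo, hi).
pose FF w := (Fl w).1.1; pose LO w := (Fl w).1.2; pose HI w := (Fl w).2.
move=> FlP.
have /choice[q qP] : forall w, exists q : bool * (int * int), ~ S w ->
    if q.1 then [/\ B w = Fin q.2.1, (q.2.1 < q.2.2)%R &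
      ~ Dlim (meets a0) (FF w) (LO w) (upd (HI w) w (Fin q.2.2))]
    else B w = Bot /\ ~ Dlim (meets a0) (FF w) (upd (LO w) w (Fin q.2.1)) (HI w).
  move=> w; have [Sw|nSw] := pselect (S w); first by exists (true, (0%R, 0%R)).
  have [_ [[l [r H]]|[l H]]] := FlP w nSw; first by exists (true, (l, r)).
  by exists (false, (l, 0%R)).
pose up w := (q w).1; pose l w := (q w).2.1; pose r w := (q w).2.2.
(* The moving end: an upper end rising from just above the fixed end l, or a lower end descending
   from 0 under [Top]. Either way the box grows with j. *)
pose own w (j : nat) : extint :=
  if up w then Fin (l w + 1 + Posz j)%R else Fin (- Posz j)%R.
pose lo' w j := if up w then LO w else upd (LO w) w (own w j).
pose hi' w j := if up w then upd (HI w) w (own w j) else HI w.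
have /choice[NN NNP] : forall w, exists N, ~ S w ->
    meets a0 (FF w) (clip N \o LO w) (clip N \o HI w).
  move=> w; have [Sw|nSw] := pselect (S w); first by exists 0.
  by have [N NP] := dense (FF w) (LO w) (HI w) (FlP w nSw).1; exists N.
have ends_mono a w j k : j <= k -> meets a (FF w) (lo' w j) (hi' w j) ->
    meets a (FF w) (lo' w k) (hi' w k).
  move=> jk H; apply: meets_mono H _ => i iF; rewrite /lo' /hi' /own; case: (up w).
    rewrite ext_lexx; split=> //; have [->|iw] := pselect (i = w).
      by rewrite !upd_same ext_le_Fin; lia.
    by rewrite !upd_other ?ext_lexx.
  rewrite ext_lexx; split=> //; have [->|iw] := pselect (i = w).
    by rewrite !upd_same ext_le_Fin; lia.
  by rewrite !upd_other ?ext_lexx.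
(* The parameters form an array with two columns: [false] holds the lower ends, [true] the upper
   ones. *)
pose chi t := cid (definable_cuts phi (FF (e t)) (fun=> false) (fun=> true)).
pose cc t j (z : cell m bool) : M := c (existT _ (row z)
  (if col z then hi' (e t) j (row z) else lo' (e t) j (row z), (projT2 z).2)).
have chiE t j a : sat (sval (chi t)) (assign a (cc t j)) <->
    meets a (FF (e t)) (lo' (e t) j) (hi' (e t) j).
  exact: (svalP (chi t)).
apply: (srd_intro Msat (chi := fun t => sval (chi t)) (c := cc)).
- exact: small_rows eI.
- by move=> t j a /chiE H; apply/chiE; exact: ends_mono H.
move=> eta F; have [eta' eta'P] := extend_along eta eI.
pose ws := map e F.
have wsS w : In w ws -> ~ S w by move=> /List.in_map_iff[t [<- _]].
pose R := ws ++ flatten (map FF ws).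
have wsR w : In w ws -> In w R by move=> ?; apply/In_cat; left.
have FR w i : In w ws -> In i (FF w) -> In i R.
  by move=> wws iF; apply/In_cat; right; exact: In_flatten_map iF.
have [N1 N1P] := bounded_on R (fun i => `|l i|%N + `|r i|%N).
have [N2 N2P] := bounded_on ws NN.
(* N exceeds every l and r in play and every bound at which [a0] meets a box. Moving ends go to N or
   -N, and N + 1 keeps the images of [Top] and [Bot] strictly outside them. *)
pose N := (N1 + N2).+1.
(* h sends the fixed parameters and the two moving columns of each row outside S to columns
   at which a0 is known to meet, respectively miss, the boxes. *)
pose h i (x : extint) : extint := if pselect (S i) is left _ then x
  else if up i then match x with
    | inl z => if (z <= l i)%R then x else
        if z == (l i + 1 + Posz (eta' i))%R then Fin (Posz N) else Fin (r i)
    | inr false => x | inr true => Fin (Posz N.+1) end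
  else match x with
    | inl z => if z == (- Posz (eta' i))%R then Fin (- Posz N)%R else Fin (l i)
    | inr false => Fin (- Posz N.+1)%R | inr true => Fin (Posz N.+1) end.
have hS i x : S i -> h i x = x by rewrite /h; case: pselect.
have hTop i : ~ S i -> h i Top = Fin (Posz N.+1).
  by rewrite /h; case: pselect => // _ _; case: (up i).
have hB i : ~ S i -> h i (B i) = clip N.+1 (B i).
  move=> nS; rewrite /h; case: pselect => // _; have := qP i nS.
  by rewrite -/(up i); case: (up i) => -[-> *] //=; case: ifP => //; rewrite -/(l i); lia.
have hown i : ~ S i -> h i (own i (eta' i)) = if up i then Fin (Posz N) else Fin (- Posz N)%R.
  move=> nS; rewrite /h /own; case: pselect => // _; case: (up i); last by rewrite eqxx.
  by rewrite eqxx; case: ifP => //; lia.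
have hpred i : ~ S i -> 0 < eta' i ->
    h i (own i (eta' i).-1) = if up i then Fin (r i) else Fin (l i).
  move=> nS e0; rewrite /h /own; case: pselect => // _; case: (up i).
    by case: ifP; [lia|]; case: eqP => //; lia.
  by case: eqP => //; lia.
(* Outside S only four columns of a row occur: its two fixed ends and its moving end at [eta'] and
   one step before. Only among these must h preserve the order. *)
pose A i (x : extint) := In i R /\ (S i \/ (~ S i /\ [\/ x = B i, x = Top,
  x = own i (eta' i) | 0 < eta' i /\ x = own i (eta' i).-1])).
have hincr i x y : A i x -> A i y -> ext_lt x y -> ext_lt (h i x) (h i y).
  move=> [iR [Si|[nS Ax]]] [_ [Si'|[nS' Ay]]] //; first by rewrite !hS.
  have := qP i nS; rewrite -/(up i) -/(l i) -/(r i) => q'; have /= iN := N1P i iR.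
  have [[[hBi hTi] hoi] hpi] := (hB i nS, hTop i nS, hown i nS, hpred i nS).
  case: Ax => [->|->|->|[e0 ->]]; case: Ay => [->|->|->|[e0' ->]];
  rewrite ?hBi ?hTi ?hoi ?hpi//; move: q' hBi hTi hoi hpi; rewrite /own /N;
  case: (up i) => -[-> *] //=;
  by match goal with H : is_true (ext_lt _ _) |- _ => move: H => /=; lia end.
pose X w j (N0 : structure L) (v : 'I_n0 + ext_cell -> N0) :=
  exists a1, in_cuts phi (v \o inr) (FF w) (lo' w j) (hi' w j) (v \o inl) a1.
have dX w j : definable (X w j) by exact: definable_cuts.
have [theta tP] := definable_ex (@some_inr _ _) (definable_all ws (fun w =>
  definable_and (dX w (eta' w)) (definable_imp (definable_const L _ (0 < eta' w))
    (definable_not (dX w (eta' w).-1))))).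
have thetaE (v : ext_cell -> M) : sat theta v <-> exists a, forall w, In w ws ->
    (exists a1, in_cuts phi v (FF w) (lo' w (eta' w)) (hi' w (eta' w)) a a1) /\
    (0 < eta' w -> ~ exists a1,
       in_cuts phi v (FF w) (lo' w (eta' w).-1) (hi' w (eta' w).-1) a a1).
  rewrite tP; split=> [[u uv H]|[a H]].
    have e' : u \o inr = v by apply: funext => z; exact: uv.
    by exists (u \o inl) => w /H; rewrite /X e'.
  by exists (assign a v); [move=> -[//|z] _ [<-]|exact: H].
have endsA w j i : In w ws -> j = eta' w \/ (0 < eta' w /\ j = (eta' w).-1) ->
    In i (FF w) -> A i (lo' w j i) /\ A i (hi' w j i).
  move=> wws jE iF; have iR := FR _ _ wws iF; rewrite /A.
  have [b1 b2] := (FlP w (wsS _ wws)).1 i.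
  suff : S i \/ (~ S i /\
      [\/ lo' w j i = B i, lo' w j i = Top, lo' w j i = own i (eta' i)
        | 0 < eta' i /\ lo' w j i = own i (eta' i).-1] /\
      [\/ hi' w j i = B i, hi' w j i = Top, hi' w j i = own i (eta' i)
        | 0 < eta' i /\ hi' w j i = own i (eta' i).-1]).
    by move=> [Si|[nS [lA hA]]]; split; split=> //; [left|left|right|right].
  have [Si|nS] := pselect (S i); [by left|right; split=> //].
  have [eL eH] := b2 nS; rewrite -/(LO w) in eL; rewrite -/(HI w) in eH.
  rewrite /lo' /hi'; have [iw|iw] := pselect (i = w); last first.
    by case: (up w); rewrite ?upd_other// eL eH; split; (exact: Or41 || exact: Or42).
  rewrite iw in eL eH *; case: (up w); rewrite upd_same ?eL ?eH; split.
  - exact: Or41.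
  - by case: jE => [->|[e0 ->]]; [apply: Or43|apply: Or44].
  - by case: jE => [->|[e0 ->]]; [apply: Or43|apply: Or44].
  - exact: Or42.
have theta_dep : depends_on M A theta.
  have dep (v v' : ext_cell -> M) : (forall z, A (row z) (col z) -> v z = v' z) ->
      sat theta v -> sat theta v'.
    move=> vv' /thetaE[a H]; apply/thetaE; exists a => w wws; have [[a1 H1] H2] := H w wws.
    split.
      by exists a1; apply: in_cuts_depends vv' H1 => i iF; apply: endsA => //; left.
    move=> e0 [a2 H3]; apply: H2 => //; exists a2.
    apply: in_cuts_depends (fun z Az => esym (vv' z Az)) H3 => i iF.
    by apply: endsA => //; right.
  by move=> v v' vv'; split; apply: dep => // z /vv'.
(* [a0] witnesses [theta] in the relabelled array; the tuple a obtained for the original columns has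
   the prescribed cuts in all selected rows. *)
have /(c_ind theta_dep hincr)/thetaE[a aP] : sat theta (c \o reindex h).
  apply/thetaE; exists a0 => w wws; have nSw := wsS w wws.
  have [b _] := FlP w nSw; rewrite -/(LO w) -/(HI w) in b.
  have wN : NN w <= N2 := N2P w wws; have qw := qP w nSw.
  rewrite -/(up w) -/(l w) -/(r w) in qw.
  have [eLw eHw] := (b w).2 nSw.
  have LO_clip i : h i (LO w i) = clip N.+1 (LO w i) /\
      ext_le (clip N.+1 (LO w i)) (clip (NN w) (LO w i)).
    have [b1 b2] := b i; have [Si|nSi] := pselect (S i).
      by have [x [y [-> _ _]]] := b1 Si; rewrite hS//; split=> //; exact: ext_lexx.
    have [-> _] := b2 nSi; rewrite hB//; split=> //.
    by have := qP i nSi; case: (q i).1 => -[-> *] /=; rewrite ext_le_Fin /N; lia.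
  have HI_clip i : h i (HI w i) = clip N.+1 (HI w i) /\
      ext_le (clip (NN w) (HI w i)) (clip N.+1 (HI w i)).
    have [b1 b2] := b i; have [Si|nSi] := pselect (S i).
      by have [x [y [_ -> _]]] := b1 Si; rewrite hS//; split=> //; exact: ext_lexx.
    have [_ ->] := b2 nSi; rewrite hTop//; split=> //=.
    by rewrite ext_le_Fin /N; lia.
  split.
    suff : meets a0 (FF w) (fun i => h i (lo' w (eta' w) i)) (fun i => h i (hi' w (eta' w) i)) by [].
    apply: meets_mono (NNP w nSw) _ => i iF /=.
    have [[hL cL] [hH cH]] := (LO_clip i, HI_clip i).
    have := hown w nSw; move: qw; rewrite /lo' /hi'; case: (up w) => qw hw; split=> //; rewrite ?hL ?hH//.
      have [->|iw] := pselect (i = w); last by rewrite upd_other// hH.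
      by rewrite upd_same hw eHw /= ext_le_Fin /N; lia.
    have [iw|iw] := pselect (i = w); last by rewrite upd_other// hL.
    by rewrite iw upd_same hw eLw qw.1 /= ext_le_Fin /N; lia.
  move=> e0; suff : ~ meets a0 (FF w) (fun i => h i (lo' w (eta' w).-1 i))
      (fun i => h i (hi' w (eta' w).-1 i)) by [].
  move=> H; have := hpred w nSw e0; move: qw H; rewrite /lo' /hi'.
  (* The failing box is missed at every clipping, in particular at N + 1, where the relabelling puts
     the end points. *)
  case: (up w) => [[_ _ nD]|[_ nD]] H hw; apply: nD; exists N.+1;
    apply: meets_mono H _ => i iF /=; have [[hL _] [hH _]] := (LO_clip i, HI_clip i);
    rewrite ?hL ?hH ext_lexx; split=> //; have [->|iw] := pselect (i = w).
  - by rewrite !upd_same hw /= ext_lexx.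
  - by rewrite !upd_other// hH ext_lexx.
  - by rewrite !upd_same hw /= ext_lexx.
  - by rewrite !upd_other// hL ext_lexx.
exists a => t tF; have tws : In (e t) ws by apply/List.in_map_iff; exists t.
have [H1 H2] := aP _ tws; rewrite eta'P in H1 H2.
split=> [|j jt]; first exact/chiE.
move=> /chiE Hj; apply: H2; first exact: leq_ltn_trans jt.
by apply: ends_mono Hj; rewrite -ltnS prednK// (leq_ltn_trans _ jt).
Qed.

End Rows.
End Main.

Theorem theorem3p1 (L : language) (T : set (sentence L))
    (Tcomplete : complete_theory T) (Tinfinite : has_infinite_model T)
    (K : Type) (M : structure L) (Mmonster : monster T K M)
    (I I0 I1 : Type) (Ismall : card_lt I K)
    (Isum : [set: option I] #= [set: (I0 + I1)%type])
    (n0 n1 : nat) (m : I -> nat)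
    (phi : forall i, formula L (('I_n0 + 'I_n1) + 'I_(m i)))
    (phi_srd : exists b : forall i, nat -> 'I_(m i) -> M,
       srd_pattern (X := ('I_n0 + 'I_n1)%type) phi b) :
  (exists (m' : I0 -> nat) (psi : forall i, formula L ('I_n0 + 'I_(m' i)))
      (c : forall i, nat -> 'I_(m' i) -> M), srd_pattern psi c) \/
  (exists (m' : I1 -> nat) (psi : forall i, formula L ('I_n1 + 'I_(m' i)))
      (c : forall i, nat -> 'I_(m' i) -> M), srd_pattern psi c).
Proof.
have [_ FK Msat _] := Mmonster; have [b b_srd] := phi_srd.
have small : card_lt (I * nat) K.
  apply: small_prod_nat Ismall FK _.
  by exists (fun n => FEq (Var L n) (Var L n)) => i j [].
have [c [c_inc c_ind c_cut]] := indiscernible_array_exists Msat small b_srd.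
have [a0 [a1 aP]] := central_realization Msat small c_cut.
have [||S [B [_ dense wit]]] := @density_dichotomy I (meets phi c a0).
- by move=> F F' lo lo' hi hi' H le; exact: meets_mono H le.
- by move=> F; exists a1.
have [[e eI]|[e eI]] := split_additive S Isum.
  right; apply: (fibre_pattern Msat small c_inc (e := fun t => sval (e t))) dense.
    by move=> t u /sval_inj/eI.
  by move=> t; exact: (svalP (e t)).
left; apply: (projection_pattern Msat small c_inc c_ind (e := fun t => sval (e t))) dense wit.
  by move=> t u /sval_inj/eI.
by move=> t; exact: (svalP (e t)).
Qed.
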